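(* Let $k\geq 2$, $t\geq 1$ and $n\geq\max\{6k+6t-1,\ k^2+kt+t+1\}$ be integers, let $G^*=K_t\vee(K_{n-k-2t+1}\cup(k+t-1)K_1)$, and let $G$ be a $t$-connected graph of order $n$. If $$\rho(\overline{G})\leq\sqrt{(k+t)(n-2t)-\tfrac32k^2+\tfrac k2-kt+\tfrac12t^2+\tfrac12t-1},$$ then $G$ has a spanning $k$-ended-tree unless $C_{n-1}(G)\cong G^*$.
   Context: All graphs are finite, simple and undirected. $\overline{G}$ is the complement of $G$ and $\rho(\cdot)$ is the largest adjacency eigenvalue. A graph is $t$-connected if it has more than $t$ vertices and remains connected whenever fewer than $t$ vertices are removed. $K_m$ is the complete graph on $m$ vertices, $mK_1$ is $m$ isolated vertices, $\cup$ denotes disjoint union and $\vee$ denotes join. A spanning $k$-ended-tree of $G$ is a spanning tree of $G$ with at most $k$ leaves. The $(n-1)$-closure $C_{n-1}(G)$ is the graph obtained from $G$ by recursively joining pairs of nonadjacent vertices whose degree sum (in the current graph) is at least $n-1$, until no such pair remains. *)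

(* Defs.v *)
From mathcomp Require Import all_boot all_order all_algebra.

Set Implicit Arguments.
Unset Strict Implicit.
Unset Printing Implicit Defensive.

Import Order.TTheory GRing.Theory Num.Theory.

Record sgraph (T : finType) := SGraph {
  edge :> rel T;
  edge_sym : symmetric edge;
  edge_irr : irreflexive edge }.

Section Graphs.
Variable T : finType.
Implicit Types (G H F : sgraph T) (S : {set T}).

Definition deg G (x : T) : nat := #|[set y | G x y]|.

Definition compl_rel G : rel T := fun x y => (x != y) && ~~ G x y.
Lemma compl_rel_sym G : symmetric (compl_rel G).
Proof. by move=> x y; rewrite /compl_rel eq_sym (edge_sym G). Qed.
Lemma compl_rel_irr G : irreflexive (compl_rel G).
Proof. by move=> x; rewrite /compl_rel eqxx. Qed.
Definition compl G := SGraph (compl_rel_sym G) (compl_rel_irr G).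

Definition add_edge_rel G (u v : T) : rel T := fun x y =>
  (x != y) && [|| G x y, (x == u) && (y == v) | (x == v) && (y == u)].
Lemma add_edge_rel_sym G u v : symmetric (add_edge_rel G u v).
Proof.
move=> x y; rewrite /add_edge_rel eq_sym (edge_sym G).
by rewrite (andbC (x == u)) (andbC (x == v)) (orbC (_ && (x == v))).
Qed.
Lemma add_edge_rel_irr G u v : irreflexive (add_edge_rel G u v).
Proof. by move=> x; rewrite /add_edge_rel eqxx. Qed.
Definition add_edge G u v :=
  SGraph (add_edge_rel_sym G u v) (add_edge_rel_irr G u v).

(* The graph G - S is connected. *)
Definition connected_off G S : Prop :=
  forall x y, x \notin S -> y \notin S ->
    connect [rel u v | [&& u \notin S, v \notin S & G u v]] x y.

Definition connected G : Prop := connected_off G set0.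

Definition t_connected (t : nat) G : Prop :=
  t < #|T| /\ forall S, #|S| < t -> connected_off G S.

(* ucycle also accepts the sequences [::] and [:: x; y] with x adjacent to y,
   whence the lower bound on the length. *)
Definition acyclic G : Prop :=
  forall c : seq T, 2 < size c -> ~ ucycle G c.

Definition is_tree G : Prop := connected G /\ acyclic G.

Definition leaves G : {set T} := [set x | deg G x == 1].

(* F has the same vertex set as G, so as a subgraph it is spanning. *)
Definition has_spanning_ended_tree (k : nat) G : Prop :=
  exists F, [/\ subrel F G, is_tree F & #|leaves F| <= k].

(* closure_of l G H: the graph H is reached from G by successively joining
   nonadjacent vertices of degree sum at least l in the current graph, and has
   no such pair itself, i.e. H is the l-closure of G. *)
Inductive closure_of (l : nat) : sgraph T -> sgraph T -> Prop :=
| ClosureStop G :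
    (forall u v, u != v -> ~~ G u v -> deg G u + deg G v < l) ->
    closure_of l G G
| ClosureJoin G u v H :
    u != v -> ~~ G u v -> l <= deg G u + deg G v ->
    closure_of l (add_edge G u v) H -> closure_of l G H.

Local Open Scope ring_scope.

Definition adjmx (R : nzRingType) G : 'M[R]_#|T| :=
  \matrix_(i, j) (G (enum_val i) (enum_val j))%:R.

Definition largest_adj_eigenvalue (R : realFieldType) G (rho : R) : Prop :=
  eigenvalue (adjmx R G) rho /\
  forall a : R, eigenvalue (adjmx R G) a -> a <= rho.

End Graphs.

Definition isomorphic (T U : finType) (G : sgraph T) (H : sgraph U) : Prop :=
  exists2 f : T -> U, bijective f & forall x y, H (f x) (f y) = G x y.

(* mK_1 and K_m *)
Definition edgeless (m : nat) : sgraph 'I_m :=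
  @SGraph 'I_m (fun _ _ => false) (fun _ _ => erefl) (fun _ => erefl).
Definition complete (m : nat) : sgraph 'I_m := compl (edgeless m).

Section Sums.
Variables (T U : finType) (G : sgraph T) (H : sgraph U).

(* b says whether the two parts are completely joined to each other. *)
Definition sum_rel (b : bool) : rel (T + U) := fun x y =>
  match x, y with
  | inl a, inl c => G a c
  | inr a, inr c => H a c
  | _, _ => b
  end.
Lemma sum_rel_sym b : symmetric (sum_rel b).
Proof. by case=> x [] y //=; apply: edge_sym. Qed.
Lemma sum_rel_irr b : irreflexive (sum_rel b).
Proof. by case=> x /=; apply: edge_irr. Qed.

Definition gunion := SGraph (sum_rel_sym false) (sum_rel_irr false).
Definition gjoin := SGraph (sum_rel_sym true) (sum_rel_irr true).
End Sums.

Definition Gstar (n k t : nat) :=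
  gjoin (complete t)
        (gunion (complete (n - k - 2 * t + 1)) (edgeless (k + t - 1))).

(* Main.v *)
(* Put s = k + t. If G + uv has a spanning tree with at most k leaves and
   d(u) + d(v) >= n - 1, then so has G: otherwise, deleting uv from the tree
   splits it into parts A and B, and edge exchanges that create no leaf show
   |N(u) :&: A| + |N(v) :&: A| <= |A| - 1, likewise for B, whence
   d(u) + d(v) <= n - 2. So one may pass to the closure H of G.
   For H, every edge xy of the complement has degree sum at least n there, so
   n e <= sum of squared degrees of the complement <= rho^2 n. The resulting bound
   e <= s (n - s) - C(s, 2) - 1, with n >= 6 s - 1, forces a clique C of H that
   misses at most s - 1 vertices.
   Now take a longest path P among those that contain C. A Chvatal-Erdos argument
   shows that P meets at least t vertices outside C, and each vertex off P
   costs at most one leaf. If there is no spanning tree with at most k leaves, all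
   these estimates are tight: exactly s - 1 vertices lie outside C, exactly t of
   them on P, and exchanging them shows that they all have the same t neighbours,
   in C. Hence H is G^*. *)

Require Import Defs.
From mathcomp Require Import all_boot all_order all_algebra.
From mathcomp Require Import complex zify ring lra.
From Stdlib Require Import Classical.
Import Order.TTheory GRing.Theory Num.Theory.

Set Implicit Arguments.
Unset Strict Implicit.
Unset Printing Implicit Defensive.

(** * Degree sums and large cliques *)

Definition clique (T : finType) (G : sgraph T) (C : {set T}) :=
  [forall x in C, forall y in C, (x != y) ==> G x y].

Definition degree_sums_below (T : finType) (l : nat) (G : sgraph T) :=
  forall u v, u != v -> ~~ G u v -> deg G u + deg G v < l.

Section Counting.
Variables (T : finType) (G : sgraph T).

Lemma cliqueP (C : {set T}) :
  reflect {in C &, forall x y, x != y -> G x y} (clique G C).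
Proof.
apply: (iffP forall_inP) => [clC x y Cx Cy | clC x Cx].
  by have /forall_inP/(_ y Cy)/implyP := clC x Cx.
by apply/forall_inP=> y Cy; apply/implyP; apply: clC.
Qed.

Lemma deg_sum x : deg G x = \sum_y G x y.
Proof. by rewrite /deg -sum1dep_card big_mkcond; apply: eq_bigr => y _; case: (G x y). Qed.

Lemma complE x y : compl G x y = (x != y) && ~~ G x y.
Proof. by []. Qed.

Lemma deg_compl x : (deg G x + deg (compl G) x).+1 = #|T|.
Proof.
rewrite /deg -cardsUI.
have -> : [set y | G x y] :&: [set y | compl G x y] = set0.
  by apply/setP=> y; rewrite !inE complE; case: (G x y); rewrite ?andbF.
rewrite cards0 addn0 -[RHS]cardsT (cardsD1 x [set: T]) inE add1n; congr _.+1.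
apply: eq_card => y; rewrite !inE complE andbT eq_sym.
by case: eqVneq => [->|]; rewrite ?edge_irr //= orbN.
Qed.

(** An edge between [A] and its complement counts at both its ends, while pairs inside [A] add at
    most [#|A| * (#|A| - 1)] to the degree sum over [A]. *)
Lemma sum_deg_ge (A : {set T}) :
  2 * (\sum_(y in A) deg G y) <= \sum_x deg G x + #|A| * (#|A| - 1).
Proof.
pose out y := \sum_(x in ~: A) G y x.
have out_le : \sum_(y in A) out y <= \sum_(x in ~: A) deg G x.
  rewrite exchange_big /=; apply: leq_sum => x _.
  rewrite deg_sum [leqRHS](bigID (mem A)) /=.
  rewrite (eq_bigr (fun y => G x y : nat)) ?leq_addr // => y _.
  by rewrite edge_sym.
have deg_le y : y \in A -> deg G y <= out y + (#|A| - 1).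
  move=> Ay; rewrite deg_sum (bigID (mem A)) /= addnC leq_add //.
    by rewrite /out; under [leqRHS]eq_bigl do rewrite inE.
  rewrite (cardsD1 y) Ay add1n subn1 /= (bigD1 y) //= edge_irr add0n.
  rewrite -sum1_card [leqRHS](eq_bigl (fun x => (x \in A) && (x != y))).
    by apply: leq_sum => x _; case: (G y x).
  by move=> x; rewrite !inE andbC.
have sum_le : \sum_(y in A) deg G y <= \sum_(y in A) out y + #|A| * (#|A| - 1).
  by rewrite -sum_nat_const -big_split; apply: leq_sum => y /deg_le.
have -> : \sum_x deg G x = \sum_(x in A) deg G x + \sum_(x in ~: A) deg G x.
  by rewrite (bigID (mem A)) /=; congr (_ + _); apply: eq_bigl => x; rewrite inE.
lia.
Qed.

(** Both sides sum over ordered adjacent pairs [(x, y)]: the squared degrees add up to the sum of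
    [deg G x], and equally of [deg G y], while the degrees count the pairs. *)
Lemma sum_deg_mul_le l : (forall x y, G x y -> l <= deg G x + deg G y) ->
  l * (\sum_x deg G x) <= 2 * (\sum_x deg G x ^ 2).
Proof.
move=> hl.
have sqE : \sum_x deg G x ^ 2 = \sum_x \sum_y deg G x * G x y.
  by apply: eq_bigr => x _; rewrite -big_distrr -deg_sum.
have sqE' : \sum_x deg G x ^ 2 = \sum_x \sum_y deg G y * G x y.
  rewrite sqE exchange_big; apply: eq_bigr => x _; apply: eq_bigr => y _.
  by rewrite edge_sym.
rewrite mul2n -addnn {1}sqE sqE' -big_split big_distrr; apply: leq_sum => x _.
rewrite [leqLHS]/= [X in l * X]deg_sum -big_split big_distrr; apply: leq_sum => y _ /=.
by case Gxy: (G x y); rewrite ?muln0 // !muln1 hl.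
Qed.

End Counting.

(** Vertices of degree at least half of [n - 1] are pairwise adjacent, so they lie in a maximal
    clique [C]. Each vertex off [C] misses a vertex of [C] and thus has large complement degree; by
    [sum_deg_ge], too many of them would exceed the bound on the complement degrees. *)
Lemma clique_of_sum_deg_compl (T : finType) (H : sgraph T) s :
  degree_sums_below (#|T| - 1) H -> 0 < s -> 6 * s <= #|T|.+1 ->
  \sum_x deg (compl H) x + 3 * s ^ 2 + 2 <= 2 * s * #|T| + s ->
  exists2 C : {set T}, clique H C & #|~: C| < s.
Proof.
set n := #|T| => closed s_gt0 sn Mle.
pose F := [set x | n - 1 <= 2 * deg H x].
have clF : clique H F.
  apply/cliqueP=> x y; rewrite !inE => Fx Fy neq_xy.
  by apply: contraT => /(closed _ _ neq_xy); lia.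
have [C /maxsetP[clC maxC] sFC] := maxset_exists clF.
exists C => //.
have outC y : y \notin C -> deg H y + #|C| < n /\ 2 * deg H y < n - 1.
  move=> nCy; split; last first.
    by move/subsetP/(_ y)/contra: sFC => /(_ nCy); rewrite inE -ltnNge.
  have [c Cc] : exists2 c, c \in C & (c != y) && ~~ H c y.
    apply/exists_inP; apply: contraT => /exists_inPn all_adj.
    have adj c : c \in C -> c != y -> H c y.
      by move=> /all_adj + ne_cy; rewrite ne_cy negbK.
    suff clyC : clique H (y |: C).
      by move: nCy; rewrite -(maxC _ clyC (subsetUr _ _)) setU11.
    apply/cliqueP=> a b; rewrite !inE.
    move=> /predU1P[->|Ca] /predU1P[->|Cb]; rewrite ?eqxx //.
    - by move=> ne; rewrite edge_sym adj // eq_sym.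
    - exact: adj.
    - exact: (cliqueP _ _ clC).
  move=> /andP[ne_cy nHcy].
  have degc : #|C| <= (deg H c).+1.
    rewrite (cardsD1 c) Cc add1n ltnS subset_leq_card //.
    apply/subsetP=> x; rewrite !inE => /andP[ne_xc Cx].
    by apply: (cliqueP _ _ clC); rewrite // eq_sym.
  have := closed _ _ ne_cy nHcy; lia.
have nE : #|C| + #|~: C| = n by rewrite cardsC.
set m := #|~: C| in nE *.
(* Complement degrees off [C] are at least [n - m] and at least half of [n]; the minimum merges both
   bounds into [n - m']. *)
pose m' := minn m (n %/ 2).
have [A sAC cardA] : exists2 A : {set T}, A \subset ~: C & #|A| = m'.
  have : m' <= m by rewrite geq_minl.
  move=> /card_geqP[r [/card_uniqP ur <- sr]]; exists [set x in r].
    by apply/subsetP=> x; rewrite inE => /sr.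
  by rewrite cardsE.
have := sum_deg_ge (compl H) A.
have : #|A| * (n - m') <= \sum_(y in A) deg (compl H) y.
  rewrite -sum_nat_const; apply: leq_sum => y Ay.
  have := subsetP sAC y Ay; rewrite inE => /outC[].
  have := deg_compl H y; rewrite -/n /m'; lia.
rewrite cardA => le1 le2.
have : m' < s.
  have : m' <= n %/ 2 by rewrite geq_minr.
  move=> half; rewrite ltnNge; apply/negP=> sm'.
  have half2 : 2 * m' <= n by lia.
  clearbody n m'; clear - sn Mle le1 le2 half2 sm'.
  (* From [2 * m' <= n] and [6 * s <= n + 1] follows [3 * (m' + s) <= 2 * n], so
     [2 * x * n - 3 * x ^ 2 + x] is at least as large at [m'] as at [s], against [le1] and [le2]. *)
  have : (m' - s) * (3 * (m' + s)) <= (m' - s) * (2 * n) by rewrite leq_mul2l; lia.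
  nia.
rewrite /m'; lia.
Qed.

(** * Trees given by parent functions *)

Section Trees.
Variable T : finType.
Implicit Types (G F : sgraph T) (r u v w x y z : T) (p : T -> T) (d : T -> nat).

Lemma connectedE G : connected G <-> forall x y, connect G x y.
Proof.
have eqc : connect [rel a b | [&& a \notin set0, b \notin set0 & G a b]] =2 connect G.
  by apply: eq_connect => a b /=; rewrite !in_set0.
split=> [con x y | con x y _ _]; last by rewrite eqc.
by rewrite -eqc; apply: con; rewrite in_set0.
Qed.

Lemma connect_edge_sym G : connect_sym G.
Proof. exact/sym_connect_sym/edge_sym. Qed.

(** The value of [p] at the root [r] is ignored. With this encoding an edge exchange is a change of
    [p] at one or two vertices. *)
Definition parent_rel r p : rel T := fun x y =>
  (x != y) && ((x != r) && (p x == y) || (y != r) && (p y == x)).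
Lemma parent_rel_sym r p : symmetric (parent_rel r p).
Proof. by move=> x y; rewrite /parent_rel eq_sym orbC. Qed.
Lemma parent_rel_irr r p : irreflexive (parent_rel r p).
Proof. by move=> x; rewrite /parent_rel eqxx. Qed.
Definition parent_graph r p := SGraph (parent_rel_sym r p) (parent_rel_irr r p).

(** The rank certifies that iterating [p] ends at [r]. It need not be the depth, so a subtree can be
    moved by shifting its ranks. *)
Definition parent_rank r p d := forall x, x != r -> d (p x) < d x.

Lemma parent_rank_neq r p d x : parent_rank r p d -> x != r -> p x != x.
Proof. by move=> rk /rk; apply: contraTneq => ->; rewrite ltnn. Qed.

Lemma parent_graph_up r p d x : parent_rank r p d -> x != r ->
  parent_graph r p x (p x).
Proof.
move=> rk xr; rewrite /= /parent_rel xr eqxx andbT.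
by rewrite eq_sym (parent_rank_neq rk xr).
Qed.

Lemma parent_graph_down r p d x y : parent_rank r p d -> x != r -> p x = y ->
  parent_graph r p y x.
Proof. by move=> rk xr <-; rewrite edge_sym; apply: parent_graph_up rk xr. Qed.

(** On a cycle, both neighbours of a vertex of maximal rank would be its parent, which is impossible
    with at least three distinct vertices. *)
Lemma parent_graph_tree r p d : parent_rank r p d -> is_tree (parent_graph r p).
Proof.
move=> rk; set F := parent_graph r p; split.
  have toR x : connect F x r.
    have [m] := ubnP (d x); elim: m x => // m IHm x le_m.
    have [-> //|xr] := eqVneq x r.
    apply: (connect_trans (connect1 (parent_graph_up rk xr))); apply: IHm.
    exact: leq_trans (rk x xr) le_m.
  apply/connectedE => x y; apply: connect_trans (toR x) _.
  by rewrite connect_edge_sym.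
have lowE x y : F x y -> d y <= d x -> y = p x.
  case/andP=> _ /orP[/andP[_ /eqP <-] //|/andP[yr /eqP pyx]].
  by rewrite -pyx leqNgt rk.
move=> c c_gt2 /andP[cyc_c uc].
have [x0 cx0] : {x | x \in c} by case: c c_gt2 {cyc_c uc} => // x c; exists x; apply: mem_head.
pose x := [arg max_(y > x0 in c) d y].
have [cx xmax] : x \in c /\ forall y, y \in c -> d y <= d x.
  by rewrite /x; case: arg_maxnP.
have nextE : next c x = p x.
  by apply: lowE; [apply: next_cycle | apply: xmax; rewrite mem_next].
have prevE : prev c x = p x.
  apply: lowE; last by apply: xmax; rewrite mem_prev.
  by rewrite edge_sym; apply: prev_cycle.
have [i s rot_c] := rot_to cx.
have us : uniq (x :: s) by rewrite -rot_c rot_uniq.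
have sz : 1 < size s by move: c_gt2; rewrite -(size_rot i) rot_c.
have : next (rot i c) x = prev (rot i c) x by rewrite next_rot // prev_rot // nextE.
rewrite rot_c; case: s us sz {rot_c} => // y [//|z s] us _ /=.
have prev_last : forall z' s', x \notin s' -> prev_at x x z' s' = last z' s'.
  move=> z' s'; elim: s' z' => [|b s' IHs] z' /=; first by rewrite eqxx.
  by rewrite inE negb_or => /andP[/negPf-> /IHs].
move: us; rewrite /= !inE !negb_or => /andP[/and3P[xy xz xs] /andP[/andP[yz ys] _]].
rewrite eqxx (negPf xy) (negPf xz) prev_last // => y_last.
by have := mem_last z s; rewrite -y_last inE (negPf yz) (negPf ys).
Qed.

Lemma leaf_nbr_uniq F x y z : deg F x = 1 -> F x y -> F x z -> y = z.
Proof.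
by move/eqP/cards1P=> [a Na] Fxy Fxz; have /set1P-> : y \in [set a];
  [|have /set1P-> : z \in [set a]]; rewrite // -Na inE.
Qed.

(** Away from the root, a vertex with a child has the parent as a second neighbour. *)
Lemma parent_graph_leaf r p d x z : parent_rank r p d ->
  x \in leaves (parent_graph r p) -> z != r -> p z = x -> x = r.
Proof.
move=> rk; rewrite inE => /eqP leaf_x zr pz; apply/eqP; apply: contraT => xr.
have E : p x = z.
  apply: leaf_nbr_uniq leaf_x (parent_graph_up rk xr) _.
  exact: parent_graph_down rk zr pz.
by have := rk z zr; have := rk x xr; rewrite E pz; lia.
Qed.

Lemma parent_graph_leaf_root r p d z1 z2 : parent_rank r p d ->
  r \in leaves (parent_graph r p) -> z1 != r -> z2 != r -> p z1 = r -> p z2 = r ->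
  z1 = z2.
Proof.
move=> rk; rewrite inE => /eqP leaf_r z1r z2r p1 p2.
by apply: leaf_nbr_uniq leaf_r _ _; apply: parent_graph_down; eassumption.
Qed.

Lemma has_spanning_parent_tree k G r p d : parent_rank r p d ->
  (forall x, x != r -> G x (p x)) -> #|leaves (parent_graph r p)| <= k ->
  has_spanning_ended_tree k G.
Proof.
move=> rk Gp le_k; exists (parent_graph r p); split=> //.
  move=> x y /andP[_ /orP[/andP[xr /eqP<-]|/andP[yr /eqP<-]]]; first exact: Gp.
  by rewrite edge_sym Gp.
exact: parent_graph_tree rk.
Qed.

(** Breadth-first search: [d x] is the length of a shortest walk from [x] to [r], and [p x] is a
    neighbour of smaller distance. *)
Lemma search_tree F r : connected F ->
  exists p d, forall x, x != r -> F x (p x) /\ d (p x) < d x.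
Proof.
move/connectedE=> con.
pose walk x m := [exists t : m.-tuple T, path F x t && (last x t == r)].
have walkP x : exists m, walk x m.
  have /connectP[t Ft lt] := con x r; exists (size t); apply/existsP.
  by exists (in_tuple t); rewrite Ft -lt /=.
pose d x := ex_minn (walkP x).
have step x : x != r -> exists y, F x y && (d y < d x).
  move=> xr; rewrite {2}/d; case: ex_minnP => m /existsP[t /andP[Ft lt]] _.
  case: m t Ft lt => [|m] t; first by rewrite tuple0 /= (negPf xr).
  case/tupleP: t => y t /= /andP[Fxy Ft] lt; exists y; rewrite Fxy ltnS.
  rewrite /d; case: ex_minnP => m' _; apply.
  by apply/existsP; exists t; rewrite Ft.
exists (fun x => odflt x [pick y | F x y && (d y < d x)]), d => x /step[y ey].
by case: pickP => [z /andP[]//|/(_ y)]; rewrite ey.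
Qed.

Definition del_edge F u v : rel T := fun x y =>
  F x y && ~~ ((x == u) && (y == v) || (x == v) && (y == u)).

Lemma del_edge_sym F u v : symmetric (del_edge F u v).
Proof.
by move=> x y; rewrite /del_edge edge_sym orbC (andbC (x == v)) (andbC (x == u)).
Qed.

Lemma tree_edge_bridge F u v : is_tree F -> F u v -> ~~ connect (del_edge F u v) u v.
Proof.
move=> [_ acF] Fuv; apply/negP=> /connectP[s0 path_s0 last_s0].
move: path_s0 last_s0 => /shortenP[s path_s us _ last_s].
have path_F : path F u s by apply: sub_path path_s => a b /andP[].
apply: (acF (u :: s)); last first.
  by rewrite /ucycle us andbT /= rcons_path path_F -last_s edge_sym.
case: s us last_s path_s {path_F} => [|a [|b s]] //= _ va.
  by rewrite va edge_irr in Fuv.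
by rewrite /del_edge va !eqxx /= andbF.
Qed.

(** Otherwise every vertex would reach [r] along parent edges other than [xy], and [xy] would not be
    a bridge. *)
Lemma tree_edge_parent F r p d x y : is_tree F ->
  (forall z, z != r -> F z (p z) /\ d (p z) < d z) ->
  F x y -> x != r /\ p x = y \/ y != r /\ p y = x.
Proof.
move=> treeF hp Fxy; apply: NNPP => noxy.
have toR z : connect (del_edge F x y) z r.
  have [m] := ubnP (d z); elim: m z => // m IHm z le_m.
  have [-> //|zr] := eqVneq z r; have [Fz dz] := hp z zr.
  apply: connect_trans (IHm _ (leq_trans dz le_m)); apply: connect1.
  rewrite /del_edge Fz; apply/negP=> /orP[]/andP[/eqP zE /eqP pzE].
    by apply: noxy; left; rewrite -zE.
  by apply: noxy; right; rewrite -zE.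
have := tree_edge_bridge treeF Fxy; rewrite (connect_trans (toR x)) //.
by rewrite (sym_connect_sym (del_edge_sym F x y)).
Qed.

(** * Exchanges in a tree after deletion of an edge *)

Section Exchange.
Variables (G : sgraph T) (k : nat) (u v : T) (p : T -> T) (d : T -> nat) (side : pred T).
Hypotheses (neq_uv : u != v) (side_u : side u) (side_v : ~~ side v).
Hypothesis forest : forall x, x != u -> x != v ->
  [/\ G x (p x), d (p x) < d x & side (p x) = side x].

(** Values of [p] at [u] and [v] are disregarded: these are the roots of the two trees left by the
    deletion of [uv], and all hypotheses on [p] become symmetric in them. *)
Let childless x := [forall y, (y != u) ==> (y != v) ==> (p y != x)].
Hypothesis le_k : #|[set x | childless x]| <= k.
Hypotheses (nGuv : ~~ G u v) (no_tree : ~ has_spanning_ended_tree k G).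

Lemma childlessP x : reflect (forall y, y != u -> y != v -> p y <> x) (childless x).
Proof.
apply: (iffP forallP) => [h y yu yv /eqP|h y]; last first.
  by apply/implyP=> yu; apply/implyP=> yv; apply/eqP/h.
by apply/negP; have := h y; rewrite yu yv.
Qed.

Lemma side_neq_v x : side x -> x != v.
Proof. by apply: contraTneq => ->. Qed.

Lemma side_rank x : side x -> x != u -> d u < d x.
Proof.
have [m] := ubnP (d x); elim: m x => // m IHm x le_m sx xu.
have [_ dp sp] := forest xu (side_neq_v sx).
have [pu|pu] := eqVneq (p x) u; first by rewrite -pu.
by apply: (ltn_trans _ dp); apply: IHm => //; [apply: leq_trans dp le_m | rewrite sp].
Qed.

(** Hanging [v] below a childless [x] would give a spanning tree of [G]. Its only possible new leaf
    is the root [u], which is paid for by [x]. *)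
Lemma no_childless_nbr x : side x -> G v x -> ~~ childless x.
Proof.
move=> sx Gvx; apply/negP=> /childlessP cx; apply: no_tree.
pose q y := if y == v then x else p y.
(* The shift lifts the whole side of [v] above the rank of [x], its new attachment. *)
pose d' y := if side y then d y else d y + d x + 1.
have xu : x != u by apply: contraNneq nGuv => <-; rewrite edge_sym.
have vu : v != u by rewrite eq_sym.
have rk : parent_rank u q d'.
  move=> y yu; rewrite /q /d'; case: (eqVneq y v) => [->|yv].
    by rewrite sx (negPf side_v) addn1 ltnS leq_addl.
  by have [_ dp ->] := forest yu yv; case: ifP; rewrite ?ltn_add2r.
apply: (has_spanning_parent_tree rk) => [y yu|].
  by rewrite /q; case: (eqVneq y v) => [->//|yv]; have [] := forest yu yv.
apply: leq_trans le_k; rewrite [leqRHS](cardsD1 x) inE.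
have -> : childless x by apply/childlessP.
have sub : leaves (parent_graph u q) \subset u |: ([set y | childless y] :\ x).
  apply/subsetP=> y leaf_y; rewrite !inE; case: eqVneq => //= yu.
  have {}leaf_y z : z != u -> q z <> y.
    by move=> zu qz; rewrite (parent_graph_leaf rk leaf_y zu qz) eqxx in yu.
  apply/andP; split.
    by apply/eqP=> yx; apply: (leaf_y v vu); rewrite /q eqxx.
  by apply/childlessP=> z zu zv pz; apply: (leaf_y z zu); rewrite /q (negPf zv).
apply: leq_trans (subset_leq_card sub) _.
by rewrite cardsU1; case: (_ \notin _).
Qed.

(* Deleting the edges uv and w (p w) and inserting uw and vx. *)
Lemma no_exchange w x : side w -> w != u -> G u w -> side x -> G v x ->
  x != p w /\ forall z, z != u -> z != v -> p z = p w -> z = w.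
Proof.
move=> sw wu Guw sx Gvx; apply: NNPP => bad; apply: no_tree.
(* The exchange can only rob [p w] of the child [w]. In either case [p w] still has a child: the new
   child [v], or the old child [z]. *)
have {bad} alt : x = p w \/ exists z, [/\ z != w, z != u, z != v & p z = p w].
  apply: NNPP => nalt; apply: bad; split.
    by apply/eqP=> xp; apply: nalt; left.
  move=> z zu zv pz; apply/eqP; apply: contraT => zw; case: nalt.
  by right; exists z.
pose q y := if y == v then x else if y == w then u else p y.
pose d' y := if side y then d y else d y + d x + 1.
have xu : x != u by apply: contraNneq nGuv => <-; rewrite edge_sym.
have vu : v != u by rewrite eq_sym.
have wv := side_neq_v sw.
have qv : q v = x by rewrite /q eqxx.
have qw : q w = u by rewrite /q (negPf wv) eqxx.
have qE z : z != v -> z != w -> q z = p z by move=> zv zw; rewrite /q (negPf zv) (negPf zw).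
have rk : parent_rank u q d'.
  move=> y yu; case: (eqVneq y v) => [->|yv].
    by rewrite qv /d' sx (negPf side_v) addn1 ltnS leq_addl.
  case: (eqVneq y w) => [->|yw]; first by rewrite qw /d' sw side_u side_rank.
  by rewrite qE // /d'; have [_ dp ->] := forest yu yv; case: ifP; rewrite ?ltn_add2r.
apply: (has_spanning_parent_tree rk) => [y yu|].
  case: (eqVneq y v) => [->|yv]; first by rewrite qv.
  case: (eqVneq y w) => [->|yw]; first by rewrite qw edge_sym.
  by rewrite qE //; have [] := forest yu yv.
apply: leq_trans le_k; apply/subset_leq_card/subsetP=> y leaf_y.
rewrite inE; apply/childlessP=> z zu zv pz.
have [yu|yu] := eqVneq y u.
  rewrite yu in leaf_y pz.
  have only a : a != u -> q a = u -> a = w.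
    by move=> au qa; apply: (parent_graph_leaf_root rk leaf_y au wu qa qw).
  have zw : z = w.
    by have [//|zw] := eqVneq z w; apply: only; rewrite ?qE.
  rewrite zw in pz; case: alt => [xp|[z' [z'w z'u z'v pz']]].
    by rewrite xp pz eqxx in xu.
  by move/eqP: (z'w); apply; apply: only; rewrite ?qE // pz'.
have {}leaf_y a : a != u -> q a <> y.
  by move=> au qa; rewrite (parent_graph_leaf rk leaf_y au qa) eqxx in yu.
have [zw|zw] := eqVneq z w; last by apply: (leaf_y z zu); rewrite qE.
case: alt => [xp|[z' [z'w z'u z'v pz']]].
  by apply: (leaf_y v vu); rewrite qv xp -zw.
by apply: (leaf_y z' z'u); rewrite qE // pz' -zw.
Qed.

(** By [no_exchange], [p] is injective on the neighbours of [u] in this side and maps them outside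
    the neighbours of [v]. Both the image and the neighbours of [v] avoid a vertex [l] of maximal
    rank, which is childless; hence the strict inequality. Without neighbours of [v], the vertex [u]
    itself is the one missed. *)
Lemma side_degrees : #|[set x | side x && G u x]| + #|[set x | side x && G v x]| <
  #|[set x | side x]|.
Proof.
set Nu := [set x | _ && G u x]; set Nv := [set x | _ && G v x]; set A := [set x | side x].
have [Nv0|[x]] := set_0Vmem Nv.
  rewrite Nv0 cards0 addn0 (cardsD1 u A) inE side_u add1n ltnS.
  apply/subset_leq_card/subsetP=> y; rewrite !inE => /andP[-> Guy]; rewrite andbT.
  by apply: contraTneq Guy => ->; rewrite edge_irr.
rewrite inE => /andP[sx Gvx].
have Nu_neq y : y \in Nu -> [/\ side y, y != u & G u y].
  rewrite inE => /andP[sy Guy]; split=> //.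
  by apply: contraTneq Guy => ->; rewrite edge_irr.
have inj_p : {in Nu &, injective p}.
  move=> y z /Nu_neq[sy yu Guy] /Nu_neq[sz zu Guz] pyz.
  by have [_ h] := no_exchange sz zu Guz sx Gvx; apply: h; rewrite ?side_neq_v.
have [l sl lmax] : exists2 l, side l & childless l.
  pose l := [arg max_(y > u | side y) d y].
  have [sl lmax] : side l /\ forall y, side y -> d y <= d l by rewrite /l; case: arg_maxnP.
  exists l => //; apply/childlessP=> y yu yv py.
  have [_ dp sp] := forest yu yv; have := lmax y; rewrite -sp py sl => /(_ isT).
  by rewrite leqNgt -py dp.
rewrite -(card_in_imset inj_p) -cardsUI.
have -> : p @: Nu :&: Nv = set0.
  apply/setP=> y; rewrite in_set0; apply/negP=> /setIP[/imsetP[w /Nu_neq[sw wu Guw] ->]].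
  by rewrite inE => /andP[sp Gvp]; have [/eqP] := no_exchange sw wu Guw sp Gvp.
rewrite cards0 addn0 (cardsD1 l A) inE sl add1n ltnS.
apply/subset_leq_card/subsetP=> y; rewrite !inE => /orP[|/andP[sy Gvy]].
  move=> /imsetP[w /Nu_neq[sw wu _] ->]; have wv := side_neq_v sw.
  have [_ _ ->] := forest wu wv; rewrite sw andbT; apply/eqP=> pl.
  exact: (childlessP _ lmax w wu wv).
rewrite sy andbT; apply/eqP=> yl; rewrite yl in sy Gvy.
by have := no_childless_nbr sy Gvy; rewrite lmax.
Qed.

End Exchange.
End Trees.

(** * The closure *)

Section Closure.
Variable T : finType.
Implicit Types (G H F : sgraph T).

Lemma add_edgeE G u v x y : add_edge G u v x y =
  (x != y) && [|| G x y, (x == u) && (y == v) | (x == v) && (y == u)].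
Proof. by []. Qed.

Lemma sub_add_edge G u v : subrel G (add_edge G u v).
Proof.
move=> x y Gxy; rewrite add_edgeE Gxy andbT.
by apply: contraTneq Gxy => ->; rewrite edge_irr.
Qed.

Lemma spanning_tree_add_edge k G u v : u != v -> ~~ G u v ->
  #|T| - 1 <= deg G u + deg G v ->
  has_spanning_ended_tree k (add_edge G u v) -> has_spanning_ended_tree k G.
Proof.
move=> neq_uv nGuv deg_uv [F [sFG treeF le_k]]; apply: NNPP => no_tree.
have subG x y : F x y -> ~~ ((x == u) && (y == v) || (x == v) && (y == u)) -> G x y.
  by move=> /sFG; rewrite add_edgeE => /andP[_ /or3P[//|->|->]]; rewrite ?orbT.
have Fuv : F u v.
  apply: contraT => nFuv; case: no_tree; exists F; split=> // x y Fxy.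
  apply: subG => //; apply: contra nFuv.
  by case/orP=> /andP[/eqP <- /eqP <-] //; rewrite edge_sym.
have [p [d hp]] := search_tree u treeF.1.
have parentE x y := @tree_edge_parent _ F u p d x y treeF hp.
have pv : p v = u.
  by have [[]|[]//] := parentE _ _ Fuv; rewrite eqxx.
pose side := connect (del_edge F u v) u.
have side_u : side u by apply: connect0.
have side_v : ~~ side v by apply: tree_edge_bridge.
have forest x : x != u -> x != v ->
    [/\ G x (p x), d (p x) < d x & side (p x) = side x].
  move=> xu xv; have [Fx dx] := hp x xu.
  have nuv : ~~ ((x == u) && (p x == v) || (x == v) && (p x == u)).
    by rewrite (negPf xu) (negPf xv).
  split=> //; first exact: subG.
  have sym_del := sym_connect_sym (del_edge_sym F u v).
  apply/esym/(same_connect_r sym_del)/connect1.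
  by rewrite /del_edge Fx.
(* The same [p] serves the complementary side with [u] and [v] interchanged, since its values at
   both are disregarded. *)
have forest' x : x != v -> x != u ->
    [/\ G x (p x), d (p x) < d x & ~~ side (p x) = ~~ side x].
  by move=> xv xu; have [? ? ->] := forest x xu xv.
have childless_leaf x : (forall y, y != u -> y != v -> p y <> x) -> x \in leaves F.
  move=> chx; rewrite inE; apply/cards1P.
  (* The tree is rooted at [u] with [p v = u], so the root keeps the neighbour [v] and any other
     vertex its parent. *)
  exists (if x == u then v else p x); apply/setP=> y; rewrite !inE.
  apply/idP/eqP=> [Fxy|->]; last first.
    by case: eqVneq => [->//|xu]; have [] := hp x xu.
  have [[xu <-]|[yu py]] := parentE _ _ Fxy; first by rewrite (negPf xu).
  have [yv|yv] := eqVneq y v; last by case: (chx y yu yv).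
  by rewrite -py yv pv eqxx.
have le_ku : #|[set x | [forall y, (y != u) ==> (y != v) ==> (p y != x)]]| <= k.
  apply: leq_trans le_k; apply/subset_leq_card/subsetP=> x; rewrite inE => /forallP ch.
  apply: childless_leaf => y yu yv /eqP py.
  by have := ch y; rewrite yu yv py.
have le_kv : #|[set x | [forall y, (y != v) ==> (y != u) ==> (p y != x)]]| <= k.
  apply: leq_trans le_k; apply/subset_leq_card/subsetP=> x; rewrite inE => /forallP ch.
  apply: childless_leaf => y yu yv /eqP py.
  by have := ch y; rewrite yu yv py.
have ltA := side_degrees neq_uv side_u side_v forest le_ku nGuv no_tree.
have nGvu : ~~ G v u by rewrite edge_sym.
have neq_vu : v != u by rewrite eq_sym.
have side_u' : ~~ ~~ side u by rewrite negbK.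
have ltB := @side_degrees _ G k v u p d (fun x => ~~ side x)
  neq_vu side_v side_u' forest' le_kv nGvu no_tree.
have splitdeg w : deg G w = #|[set x | side x && G w x]| + #|[set x | ~~ side x && G w x]|.
  rewrite /deg -(cardsID [set x | side x]); congr (_ + _); apply: eq_card => x.
    by rewrite !inE andbC.
  by rewrite !inE.
have splitT : #|T| = #|[set x | side x]| + #|[set x | ~~ side x]|.
  by rewrite -(cardsC [set x | side x]); congr (_ + _); apply: eq_card => x; rewrite !inE.
move: deg_uv; rewrite !splitdeg; lia.
Qed.

(** Induction on the number of nonadjacent pairs, which every join decreases; the last clause
    carries trees back through the joins. *)
Lemma closure_exists k G : exists H,
  [/\ closure_of (#|T| - 1) G H, subrel G H, degree_sums_below (#|T| - 1) H &
      has_spanning_ended_tree k H -> has_spanning_ended_tree k G].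
Proof.
have [m] := ubnP #|[set e : T * T | ~~ G e.1 e.2]|; elim: m G => // m IHm G le_m.
have [/forallP ok|/forallPn[u /forallPn[v]]] :=
    boolP [forall u, forall v, (u != v) ==> ~~ G u v ==> (deg G u + deg G v < #|T| - 1)].
  have closed : degree_sums_below (#|T| - 1) G.
    move=> u v uv nG; have /forallP/(_ v) := ok u.
    by rewrite uv nG.
  by exists G; split=> //; apply: ClosureStop.
rewrite !negb_imply -leqNgt => /and3P[uv nG le_deg].
have [|H [clH sH closed back]] := IHm (add_edge G u v).
  rewrite -ltnS; apply: leq_trans le_m; rewrite ltnS; apply/proper_card/properP; split.
    apply/subsetP=> -[x y]; rewrite !inE /=; apply: contra; exact: sub_add_edge.
  exists (u, v); rewrite !inE //= ?uv //.
  by rewrite negbK -[X in is_true X]/(add_edge G u v u v) add_edgeE uv !eqxx orbT.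
exists H; split=> //.
- exact: (ClosureJoin uv nG le_deg).
- by move=> x y Gxy; apply/sH/sub_add_edge.
- by move=> /back; apply: spanning_tree_add_edge.
Qed.

Lemma connected_off_sub G H S : subrel G H -> connected_off G S -> connected_off H S.
Proof.
move=> sGH con x y nx ny; have := con x y nx ny; apply: connect_sub.
by move=> a b /and3P[na nb /sGH Hab]; apply: connect1; rewrite /= na nb.
Qed.

Lemma t_connected_sub t G H : subrel G H -> t_connected t G -> t_connected t H.
Proof. by move=> sGH [lt_t con]; split=> // S /con; apply: connected_off_sub. Qed.

End Closure.

(** * Growing a tree from a path *)

Section Growth.
Variables (T : finType) (G : sgraph T).

(* A tree on S with root r, all of whose leaves lie in L. *)
Definition partial_tree r (S L : {set T}) := exists (p : T -> T) (d : T -> nat),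
  [/\ r \in S, r \in L,
      forall x, x \in S -> x != r -> [/\ p x \in S, G x (p x) & d (p x) < d x] &
      forall x, x \in S -> x \notin L -> exists y, [/\ y \in S, y != r & p y = x]].

Lemma partial_tree_spanning r L : partial_tree r setT L ->
  has_spanning_ended_tree #|L| G.
Proof.
move=> [p [d [_ rL hp child]]].
have rk : parent_rank r p d by move=> x xr; have [] := hp x (in_setT x) xr.
apply: (has_spanning_parent_tree rk) => [x xr|]; first by have [] := hp x (in_setT x) xr.
apply/subset_leq_card/subsetP=> x leaf_x; apply: contraT => nxL.
have [y [_ yr py]] := child x (in_setT x) nxL.
by rewrite (parent_graph_leaf rk leaf_x yr py) rL in nxL.
Qed.

Lemma partial_tree_sub r S (L L' : {set T}) : L \subset L' -> partial_tree r S L ->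
  partial_tree r S L'.
Proof.
move=> /subsetP sL [p [d [rS rL hp child]]]; exists p, d; split=> //; first exact: sL.
by move=> x xS nxL'; apply: child => //; apply: contra nxL'; apply: sL.
Qed.

(** The vertex [y] gets the child [x] and leaves the set of possible leaves. The root is always put
    back, because one child does not prevent it from being a leaf. *)
Lemma partial_tree_grow r S L x y : partial_tree r S L ->
  x \notin S -> y \in S -> G x y ->
  partial_tree r (x |: S) (r |: (x |: (L :\ y))).
Proof.
move=> [p [d [rS rL hp child]]] nxS yS Gxy.
have neq_x z : z \in S -> z != x by apply: contraTneq => ->.
exists (fun z => if z == x then y else p z), (fun z => if z == x then (d y).+1 else d z).
split; rewrite ?setU11 ?setU1r // => z.
  rewrite !inE; case: eqVneq => [->|zx] /= => [_ _|zS zr].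
    by rewrite yS orbT (negPf (neq_x _ yS)).
  by have [pS Gp dp] := hp z zS zr; rewrite (negPf (neq_x _ pS)) pS orbT.
rewrite !inE !negb_or negb_and negbK => zS /and3P[zr zx /predU1P[zy|nzL]].
  by exists x; rewrite setU11 eqxx zy (eq_sym x r) neq_x.
rewrite (negPf zx) /= in zS; have [a [aS ar pa]] := child z zS nzL.
by exists a; rewrite setU1r // (negPf (neq_x _ aS)).
Qed.

Lemma connected_cut (S : {set T}) x y : connected G -> x \in S -> y \notin S ->
  exists a b, [/\ a \in S, b \notin S & G a b].
Proof.
move=> con xS nyS; apply: NNPP => nocut.
have clS : closed G S.
  apply: intro_closed; first exact: connect_edge_sym.
  by move=> a b Gab aS; apply: contraT => nbS; case: nocut; exists a, b.
have := closed_connect clS ((connectedE G).1 con x y).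
by rewrite xS (negPf nyS).
Qed.

(** Missing vertices are attached one at a time, each costing at most one leaf. *)
Lemma partial_tree_extend r S L : connected G -> partial_tree r S L ->
  has_spanning_ended_tree (#|L| + #|~: S|) G.
Proof.
move=> con; have [m] := ubnP #|~: S|; elim: m S L => // m IHm S L le_m pt.
have [CS0|[z]] := set_0Vmem (~: S).
  rewrite CS0 cards0 addn0; apply: (@partial_tree_spanning r).
  by rewrite -(setCK S) CS0 setC0 in pt.
rewrite inE => nzS.
have rS : r \in S by case: pt => p [d []].
have [y [x [yS nxS Gyx]]] := connected_cut con rS nzS.
have pt' : partial_tree r (x |: S) (x |: L).
  apply: partial_tree_sub (partial_tree_grow pt nxS yS _); last by rewrite edge_sym.
  have rL : r \in L by case: pt => p [d []].
  apply/subsetP=> a; rewrite !inE => /or3P[/eqP->|->//|/andP[_ ->]]; by rewrite ?rL orbT.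
have cardS : #|~: S| = #|~: (x |: S)|.+1.
  rewrite (cardsD1 x) inE nxS add1n; congr _.+1; apply: eq_card => a.
  by rewrite !inE negb_or.
have {}le_m : #|~: (x |: S)| < m by rewrite -ltnS -cardS.
have [F [sF tF le_F]] := IHm _ _ le_m pt'; exists F; split=> //.
apply: leq_trans le_F _; rewrite cardS cardsU1 addnS -addSn leq_add2r.
by case: (_ \notin _).
Qed.

Lemma path_partial_tree x s : uniq (x :: s) -> path G x s ->
  partial_tree x [set a in x :: s] [set x; last x s].
Proof.
elim/last_ind: s => [|s z IHs].
  move=> _ _; exists id, (fun=> 0); rewrite !inE eqxx; split=> // a; rewrite !inE.
    by move=> /eqP->; rewrite eqxx.
  by move=> ->.
rewrite -rcons_cons rcons_uniq rcons_path => /andP[nz us] /andP[path_s Gz].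
have pt := IHs us path_s.
have nz' : z \notin [set a in x :: s] by rewrite inE.
have lasts : last x s \in [set a in x :: s] by rewrite inE mem_last.
rewrite edge_sym in Gz; have := partial_tree_grow pt nz' lasts Gz; rewrite last_rcons.
have -> : z |: [set a in x :: s] = [set a in rcons (x :: s) z].
  by apply/setP=> a; rewrite in_setU1 !in_set mem_rcons [RHS]in_cons.
apply: partial_tree_sub; apply/subsetP=> a; rewrite !inE.
by case: (a == x); case: (a == z); case: (a == last x s).
Qed.

Lemma card_compl_uniq (s : seq T) : uniq s -> #|~: [set a in s]| = #|T| - size s.
Proof. by move=> us; rewrite cardsCs setCK cardsE (card_uniqP us). Qed.

Lemma spanning_tree_of_path x s : connected G -> uniq (x :: s) -> path G x s ->
  has_spanning_ended_tree (2 + (#|T| - size (x :: s))) G.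
Proof.
move=> con us path_s; have := partial_tree_extend con (path_partial_tree us path_s).
rewrite card_compl_uniq // => -[F [sF tF le_F]]; exists F; split=> //.
by apply: leq_trans le_F _; rewrite leq_add2r cards2; case: (_ == _).
Qed.

(** Hanging [y] below [w] and [z] below [y] absorbs two vertices at the price of one leaf, saving
    one against [spanning_tree_of_path]. *)
Lemma spanning_tree_of_path_edge x s w y z : connected G -> uniq (x :: s) -> path G x s ->
  w \in x :: s -> y \notin x :: s -> z \notin x :: s -> G w y -> G y z ->
  has_spanning_ended_tree (1 + (#|T| - size (x :: s))) G.
Proof.
move=> con us path_s ws ny nz Gwy Gyz.
have neq_yz : y != z by apply: contraTneq Gyz => ->; rewrite edge_irr.
have pt := path_partial_tree us path_s.
have ny' : y \notin [set a in x :: s] by rewrite inE.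
have ws' : w \in [set a in x :: s] by rewrite inE.
rewrite edge_sym in Gwy; have pt1 := partial_tree_grow pt ny' ws' Gwy.
have nz' : z \notin y |: [set a in x :: s] by rewrite in_setU1 negb_or eq_sym neq_yz inE.
rewrite edge_sym in Gyz; have pt2 := partial_tree_grow pt1 nz' (setU11 _ _) Gyz.
have := partial_tree_extend con (partial_tree_sub (L' := z |: [set x; last x s]) _ pt2).
set S := z |: (y |: _); set L := z |: [set x; last x s].
have cardS : #|~: S| = #|T| - size (x :: s) - 2.
  rewrite -(subnDA) cardsCs setCK /S cardsU1 nz' cardsU1 ny' cardsE (card_uniqP us).
  by rewrite add1n add1n addn2.
have le2 : size (x :: s) + 2 <= #|T|.
  have := max_card [set a in [:: z, y, x & s]]; rewrite cardsE.
  have /card_uniqP-> : uniq [:: z, y, x & s].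
    by rewrite !cons_uniq -cons_uniq us ny andbT in_cons negb_or eq_sym neq_yz nz.
  by rewrite /= addn2.
rewrite cardS => -[|F [sF tF le_F]].
  apply/subsetP=> a; rewrite !inE.
  by case: (a == x); case: (a == z); case: (a == last x s); case: (a == y); case: (a == w).
exists F; split=> //; apply: leq_trans le_F _.
apply: (@leq_trans (3 + (#|T| - size (x :: s) - 2))); last by lia.
rewrite leq_add2r /L cardsU1 cards2.
by case: (_ \notin _); case: (_ == _).
Qed.

End Growth.

(** * Longest paths containing a clique *)

Section SortedCat.
Variables (T : eqType) (e : rel T) (x0 : T).
Implicit Types s a b : seq T.

Lemma sorted_cat a b : sorted e (a ++ b) =
  [&& sorted e a, sorted e b & nilp a || nilp b || e (last x0 a) (head x0 b)].
Proof.
case: a => [|x a] /=; first by rewrite andbT.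
rewrite cat_path; case: b => [|y b] /=; first by rewrite !andbT.
by rewrite (andbC (e _ _)).
Qed.

Lemma last_take m s : 0 < m <= size s -> last x0 (take m s) = nth x0 s m.-1.
Proof. by case/andP=> m0 ms; rewrite -nth_last size_takel // nth_take // prednK. Qed.

Lemma head_drop m s : head x0 (drop m s) = nth x0 s m.
Proof. by rewrite -nth0 nth_drop addn0. Qed.

Lemma take_join m s y : m <= size s -> (m == 0) || e (nth x0 s m.-1) y ->
  nilp (take m s) || e (last x0 (take m s)) y.
Proof.
move=> ms /orP[/eqP-> //|]; first by rewrite take0.
by case: m ms => [|m] ms; [rewrite take0 | rewrite last_take // => ->; rewrite orbT].
Qed.

Lemma drop_join m s y : m <= size s -> (m == size s) || e y (nth x0 s m) ->
  nilp (drop m s) || e y (head x0 (drop m s)).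
Proof.
by move=> ms /orP[/eqP-> //|]; [rewrite drop_size | rewrite head_drop => ->; rewrite orbT].
Qed.

Lemma head_rev s : head x0 (rev s) = last x0 s.
Proof. by elim/last_ind: s => // s x _; rewrite rev_rcons last_rcons. Qed.

Lemma last_rev s : last x0 (rev s) = head x0 s.
Proof. by rewrite -head_rev revK. Qed.

End SortedCat.

Section MaxPath.
Variables (T : finType) (H : sgraph T) (C : {set T}).
Hypothesis clC : clique H C.
Implicit Types P Q s : seq T.

Lemma sorted_revE s : sorted H (rev s) = sorted H s.
Proof. by rewrite rev_sorted; apply: eq_sorted => x y; rewrite edge_sym. Qed.

Definition covering_path P := [/\ uniq P, sorted H P & {subset C <= P}].

Definition max_covering_path P :=
  covering_path P /\ forall Q, covering_path Q -> size Q <= size P.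

(** Any enumeration of the clique [C] is already a covering path, and sizes are bounded by
    [#|T|]. *)
Lemma max_covering_path_exists : exists P, max_covering_path P.
Proof.
suff ind m Q : covering_path Q -> #|T| - size Q < m -> exists P, max_covering_path P.
  apply: (ind (#|T| - size (enum C)).+1 (enum C)) => //.
  split; [exact: enum_uniq | | by move=> x; rewrite mem_enum].
  have : {in C &, forall x y, x != y -> H x y} by apply/cliqueP.
  have : uniq (enum C) by apply: enum_uniq.
  have : {subset enum C <= C} by move=> x; rewrite mem_enum.
  case: (enum C) => // x s; elim: s x => //= y s IHs x sub /andP[xs us] cl.
  rewrite cl ?sub ?inE ?eqxx ?orbT //=; last first.
    by apply: contraNneq xs => ->; apply: mem_head.
  by apply: IHs => // z zs; apply: sub; rewrite inE zs orbT.
elim: m Q => // m IHm Q cQ ltm.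
have [maxQ|nmax] := classic (max_covering_path Q); first by exists Q.
have [Q' [cQ' lt]] : exists Q', covering_path Q' /\ size Q < size Q'.
  apply: NNPP => none; apply: nmax; split=> // Q' cQ'.
  by rewrite leqNgt; apply/negP=> lt; apply: none; exists Q'.
apply: (IHm Q' cQ').
have le : size Q' <= #|T| by case: cQ' => /card_uniqP<- _ _; apply: max_card.
lia.
Qed.

Section Attachments.
Variables (P : seq T) (x0 : T) (D : {set T}).
Hypothesis maxP : max_covering_path P.
Hypothesis D_off : {in D, forall y, y \notin P}.
Hypothesis D_linked : {in D &, forall y z, exists s,
  [/\ path H y s, uniq (y :: s), last y s = z & {subset y :: s <= D}]}.
Hypothesis D_neq0 : D != set0.

Definition attached i := [exists y in D, H (nth x0 P i) y].
(* Prepending to P a virtual vertex attached to D, these are the successors of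
   the attached vertices. *)
Definition start i := (i == 0) || attached i.-1.

Lemma no_detour Q s : sorted H Q -> perm_eq Q (s ++ P) -> uniq s ->
  {subset s <= D} -> s = [::].
Proof.
have [[uP _ sCP] max] := maxP; move=> sQ pQ us sD; apply/nilP.
have cQ : covering_path Q.
  split=> //; last by move=> x /sCP xP; rewrite (perm_mem pQ) mem_cat xP orbT.
  rewrite (perm_uniq pQ) cat_uniq us uP andbT; apply/hasPn=> x xP.
  by apply: contraL xP => /sD/D_off.
by have := max Q cQ; rewrite (perm_size pQ) size_cat -{2}[size P]add0n leq_add2r leqn0.
Qed.

Lemma attachedP i : reflect (exists2 y, y \in D & H (nth x0 P i) y) (attached i).
Proof. exact: exists_inP. Qed.

(** Otherwise a detour through [D] fits between the positions [m - 1] and [m]; for [m = 0] it is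
    prepended and for [m = size P] appended. *)
Lemma start_not_attached m : m <= size P -> start m ->
  (m == size P) || attached m -> False.
Proof.
move=> le_m st att; have [[uP sP _] _] := maxP.
have [y [z [yD zD stE attE]]] : exists y z, [/\ y \in D, z \in D,
    (m == 0) || H (nth x0 P m.-1) y & (m == size P) || H (nth x0 P m) z].
  have [d dD] : exists d, d \in D by apply/set0Pn.
  case/orP: st => [/eqP m0|/attachedP[y yD Hy]]; case/orP: att => [/eqP mP|/attachedP[z zD Hz]].
  - by exists d, d; rewrite {1}m0 mP !eqxx.
  - by exists z, z; rewrite m0 eqxx -m0 Hz orbT.
  - by exists y, y; rewrite Hy orbT mP eqxx.
  - by exists y, z; rewrite Hy Hz !orbT.
have [s [path_s us last_s sD]] := D_linked yD zD.
suff : y :: s = [::] by [].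
apply: (@no_detour (take m P ++ (y :: s) ++ drop m P)) => //; last first.
  by rewrite -{3}(cat_take_drop m P) perm_catCA.
rewrite !(sorted_cat _ x0) take_sorted // drop_sorted // [sorted H (y :: s)]/= path_s.
rewrite edge_sym in attE; have := take_join le_m stE; have := drop_join le_m attE.
by rewrite [X in _ -> _ -> X]/= last_s => -> /=; rewrite orbF.
Qed.

(** If the two were adjacent, a longer path would follow [P] up to [m - 1], cross [D] to [m' - 1],
    run back to [m], jump to [m'] and continue to the end. *)
Lemma start_independent m m' : m < m' < size P -> start m -> start m' ->
  ~~ H (nth x0 P m) (nth x0 P m').
Proof.
move=> /andP[mm' m'P] st st'; apply/negP=> Hmm'; have [[uP sP _] _] := maxP.
have [z zD Hz] : exists2 z, z \in D & H (nth x0 P m'.-1) z.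
  by apply/attachedP; case/orP: st' => // /eqP m'0; rewrite m'0 in mm'.
have [y yD stE] : exists2 y, y \in D & (m == 0) || H (nth x0 P m.-1) y.
  case/orP: st => [->|/attachedP[y yD Hy]]; first by exists z.
  by exists y; rewrite // Hy orbT.
have [s [path_s us last_s sD]] := D_linked yD zD.
pose B := drop m (take m' P).
have le_m'P := ltnW m'P; have le_mm' := ltnW mm'.
have le_mP := leq_trans le_mm' le_m'P.
have idx : m + (m' - m).-1 = m'.-1 by clear -mm'; lia.
have defP : P = take m P ++ B ++ drop m' P.
  by rewrite -(take_takel P le_mm') catA cat_take_drop cat_take_drop.
have size_B : size B = m' - m by rewrite size_drop size_takel.
have headB : head x0 B = nth x0 P m by rewrite head_drop nth_take.
have lastB : last x0 B = nth x0 P m'.-1.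
  by rewrite -nth_last nth_drop size_B idx nth_take // ltn_predL (leq_ltn_trans _ mm').
suff : y :: s = [::] by [].
apply: (@no_detour (take m P ++ (y :: s) ++ rev B ++ drop m' P)) => //; last first.
  by rewrite {3}defP perm_catCA !perm_cat2l perm_cat2r perm_rev.
have nB : nilp (rev B) = false by rewrite /nilp size_rev size_B subn_eq0 leqNgt mm'.
rewrite !(sorted_cat _ x0) sorted_revE /B !drop_sorted ?take_sorted // -/B.
rewrite [sorted H (y :: s)]/= path_s last_rev headB head_drop Hmm' !orbT !andbT /=.
have := take_join le_mP stE; rewrite /= [in X in _ -> X]orbAC => -> /=; rewrite andbT.
rewrite last_s; have -> : head x0 (rev B ++ drop m' P) = head x0 (rev B).
  by case: (rev B) nB.
by rewrite head_rev lastB edge_sym Hz orbT.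
Qed.

End Attachments.
End MaxPath.

(** * Attachments of a component off a longest path *)

Section Detached.
Variables (T : finType) (H : sgraph T) (C : {set T}) (t : nat) (x0 : T).
Hypotheses (clC : clique H C) (conH : t_connected t H) (t_gt0 : 0 < t) (le_tC : t <= #|C|).
Implicit Types (P s : seq T) (D : {set T}).

(** This says that [D] is a connected component of [H] minus the vertices of [P], in the form that
    detours and cuts use. *)
Definition detached P D :=
  [/\ D != set0, {in D, forall y, y \notin P},
      {in D &, forall y z, exists s,
        [/\ path H y s, uniq (y :: s), last y s = z & {subset y :: s <= D}]} &
      {in D, forall y z, z \notin P -> H y z -> z \in D}].

Definition attachments P D := [set x in P | [exists y in D, H x y]].

Lemma mem_attachments P D i : i < size P ->
  (nth x0 P i \in attachments P D) = attached H P x0 D i.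
Proof. by move=> ltP; rewrite inE mem_nth. Qed.

Lemma component_detached P o : o \notin P -> exists D, detached P D.
Proof.
move=> nPo; pose e : rel T := [rel u v | [&& u \notin P, v \notin P & H u v]].
have sym_e : connect_sym e.
  by apply: sym_connect_sym => u v; rewrite /e /= edge_sym andbCA.
exists [set y | connect e o y]; split.
- by apply/set0Pn; exists o; rewrite inE connect0.
- move=> y; rewrite inE => /connectP[s path_s ->].
  case/lastP: s path_s => [//|s z]; rewrite rcons_path last_rcons => /andP[_].
  by case/and3P.
- move=> y z; rewrite !inE => oy oz.
  have /connectP[s0 path_s0 zE] : connect e y z by rewrite (connect_trans _ oz) // sym_e.
  case/shortenP: path_s0 zE => s path_s us _ zE; exists s; split=> //.
    by apply: sub_path path_s => a b /and3P[].
  move=> a; rewrite inE => as_; rewrite inE; apply: (connect_trans oy).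
  have [s1 [s2 [sE aE]]] : exists s1 s2, s = s1 ++ s2 /\ a = last y s1.
    case/predU1P: as_ => [->|]; first by exists [::], s.
    by case/splitPr=> s1 s2; exists (rcons s1 a), s2; rewrite cat_rcons last_rcons.
  move: path_s; rewrite sE cat_path => /andP[path_s1 _].
  by apply/connectP; exists s1.
- move=> y; rewrite inE => oy z nPz Hyz; rewrite inE.
  apply: (connect_trans oy); apply: connect1; rewrite /e /= nPz Hyz andbT.
  move: oy => /connectP[s path_s ->].
  rewrite andbT; case/lastP: s path_s => [//|s w]; rewrite rcons_path last_rcons => /andP[_].
  by case/and3P.
Qed.

(** Fewer than [t] attachments would leave some vertex of [C] and separate it from [D], against
    [t]-connectedness. *)
Lemma card_attachments_ge P D : {subset C <= P} -> detached P D -> t <= #|attachments P D|.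
Proof.
move=> sCP [/set0Pn[y yD] offD _ closedD]; rewrite leqNgt; apply/negP=> lt_t.
set X := attachments P D in lt_t.
have [c cC ncX] : exists2 c, c \in C & c \notin X.
  apply/exists_inP; apply: contraLR lt_t => /exists_inPn sCX.
  rewrite -leqNgt (leq_trans le_tC) // subset_leq_card //.
  by apply/subsetP=> c /sCX; rewrite negbK.
have nyX : y \notin X by rewrite inE (negPf (offD y yD)).
have := conH.2 X lt_t y c nyX ncX.
set e := (e in connect e).
have clD : closed e D.
  have half a b : e a b -> a \in D -> b \in D.
    move=> /and3P[naX nbX Hab] aD; have [bP|bP] := boolP (b \in P); last exact: closedD bP Hab.
    by move: nbX; rewrite inE bP; case/exists_inP; exists a; rewrite // edge_sym.
  move=> a b eab; apply/idP/idP; first exact: half eab.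
  by apply: half; move: eab; rewrite /e /= edge_sym andbCA.
move/(closed_connect clD); rewrite yD => /esym /offD.
by rewrite sCP.
Qed.

Section Tight.
Variables (P : seq T) (D : {set T}).
Hypotheses (maxP : max_covering_path H C P) (detD : detached P D).
Let X := attachments P D.
Let starts := start H P x0 D.
Let Z := [set x in P | starts (index x P)].

Lemma not_start_attached m : m <= size P -> starts m ->
  (m == size P) || attached H P x0 D m -> False.
Proof. by case: detD => D0 offD linkD _; apply: (start_not_attached maxP offD linkD D0). Qed.

Lemma starts_independent m m' : m < size P -> m' < size P -> m != m' ->
  starts m -> starts m' -> ~~ H (nth x0 P m) (nth x0 P m').
Proof.
move=> mP m'P neq st st'; have [D0 offD linkD _] := detD.
case: (ltngtP m m') neq => // lt _; last rewrite edge_sym;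
  by apply: (start_independent maxP offD linkD); rewrite ?lt ?mP ?m'P.
Qed.

Lemma size_path_gt0 : 0 < size P.
Proof.
have [c cC] : exists c, c \in C by apply/card_gt0P; apply: leq_trans le_tC.
by have [[_ _ /(_ c cC)]] := maxP; case: (P).
Qed.

Lemma starts_clique m m' : m < size P -> m' < size P -> starts m -> starts m' ->
  nth x0 P m \in C -> nth x0 P m' \in C -> m = m'.
Proof.
move=> mP m'P st st' mC m'C; apply/eqP; apply: contraT => neq.
have := starts_independent mP m'P neq st st'.
have [[uP _ _] _] := maxP.
by rewrite (cliqueP _ _ clC) // nth_uniq.
Qed.

(** The starts include the first vertex and the successors of all attachments; successors exist
    because the last vertex of [P] is not attached. *)
Lemma card_starts : #|X| < #|Z|.
Proof.
have P_gt0 := size_path_gt0; have [[uP _ _] _] := maxP.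
pose next x := nth x0 P (index x P).+1.
have ltX x : x \in X -> (index x P).+1 < size P.
  move=> Xx; have xP : x \in P by move: Xx; rewrite inE => /andP[].
  have ltx : index x P < size P by rewrite index_mem.
  have att : attached H P x0 D (index x P) by rewrite -mem_attachments // nth_index.
  rewrite ltn_neqAle ltx andbT; apply/eqP=> sz.
  by apply: (@not_start_attached (size P)); rewrite // -?sz ?eqxx // /starts /start att orbT.
have inj_next : {in X &, injective next}.
  move=> x y Xx Xy /eqP; rewrite nth_uniq ?ltX // => /eqP[].
  have [xP yP] : x \in P /\ y \in P by move: Xx Xy; rewrite !inE => /andP[-> _] /andP[].
  exact: (@index_inj _ x0 P _ _ xP yP).
have sZ : nth x0 P 0 |: next @: X \subset Z.
  apply/subsetP=> z; rewrite in_setU1 => /predU1P[->|/imsetP[x Xx ->]].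
    by rewrite inE mem_nth // index_uniq // /starts /start eqxx.
  rewrite inE mem_nth ?ltX // index_uniq ?ltX // /starts /start /=.
  have xP : x \in P by move: Xx; rewrite inE => /andP[].
  by rewrite -mem_attachments ?index_mem // nth_index.
apply: leq_trans (subset_leq_card sZ); rewrite cardsU1 card_in_imset //.
have -> : nth x0 P 0 \notin next @: X; last by [].
apply/negP=> /imsetP[x Xx /eqP]; rewrite nth_uniq ?ltX //.
Qed.

Lemma card_path_outside_clique : #|[set x in P] :\: C| = size P - #|C|.
Proof.
have [[uP _ sCP] _] := maxP.
rewrite cardsD (setIidPr _) ?cardsE ?(card_uniqP uP) //.
by apply/subsetP=> x /sCP; rewrite inE.
Qed.

(** Starts are independent, so at most one of them lies in the clique. *)
Lemma card_starts_outside_clique : #|X| <= #|Z :\: C|.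
Proof.
have [[uP _ _] _] := maxP.
have : #|Z :&: C| <= 1.
  apply/card_le1_eqP=> x y /setIP[]; rewrite !inE.
  move=> /andP[xP stx] xC /andP[/andP[yP sty] yC].
  by apply: (@index_inj _ x0 P _ _ yP xP); apply: starts_clique; rewrite ?index_mem ?nth_index.
have := card_starts; rewrite -(cardsID C Z); lia.
Qed.

Lemma sub_starts_path : Z :\: C \subset [set x in P] :\: C.
Proof. by apply: setSD; apply/subsetP=> x; rewrite !inE => /andP[]. Qed.

Lemma covering_path_size_ge : #|C| + t <= size P.
Proof.
have [[_ _ sCP] _] := maxP.
have := subset_leq_card sub_starts_path; rewrite card_path_outside_clique.
have := card_starts_outside_clique; have := card_attachments_ge sCP detD; rewrite -/X.
have : #|C| <= size P by rewrite cardE uniq_leq_size ?enum_uniq // => x; rewrite mem_enum => /sCP.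
lia.
Qed.

Hypothesis size_P : size P = #|C| + t.

Lemma card_attachments : #|X| = t.
Proof.
have [[_ _ sCP] _] := maxP.
have := subset_leq_card sub_starts_path; rewrite card_path_outside_clique size_P addKn.
have := card_starts_outside_clique; have := card_attachments_ge sCP detD; rewrite -/X.
lia.
Qed.

(** The hypothesis [size_P] makes every inequality behind [covering_path_size_ge] an equality, so
    the starts outside [C] exhaust the path outside [C]. *)
Lemma outside_clique_start m : m < size P -> nth x0 P m \notin C -> starts m.
Proof.
move=> mP mC; have [[uP _ _] _] := maxP.
have eqZ : Z :\: C = [set x in P] :\: C.
  apply/eqP; rewrite eqEcard sub_starts_path card_path_outside_clique size_P addKn.
  by rewrite -card_attachments card_starts_outside_clique.
have : nth x0 P m \in Z :\: C by rewrite eqZ !inE mC mem_nth.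
by rewrite !inE index_uniq // => /and3P[].
Qed.

End Tight.

Lemma max_covering_path_rev P : max_covering_path H C P -> max_covering_path H C (rev P).
Proof.
move=> [[uP sP sCP] max]; split; last by move=> Q /max; rewrite size_rev.
split; [by rewrite rev_uniq | by rewrite sorted_revE | by move=> x; rewrite mem_rev; apply: sCP].
Qed.

Lemma detached_rev P D : detached P D -> detached (rev P) D.
Proof.
move=> [D0 offD linkD closedD]; split=> // y yD; first by rewrite mem_rev offD.
by move=> z; rewrite mem_rev; apply: closedD.
Qed.

(** This is [outside_clique_start] for the reversed path, in which position [m] becomes
    [size P - m.+1]. *)
Lemma outside_clique_end P D m : max_covering_path H C P -> detached P D ->
  size P = #|C| + t -> m < size P -> nth x0 P m \notin C ->
  (m.+1 == size P) || attached H P x0 D m.+1.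
Proof.
move=> maxP detD size_P mP mC.
have := @outside_clique_start (rev P) D (max_covering_path_rev maxP) (detached_rev detD).
rewrite size_rev => /(_ size_P (size P - m.+1)).
have -> : nth x0 (rev P) (size P - m.+1) = nth x0 P m.
  by rewrite nth_rev; [congr nth | ]; lia.
move=> st; have {st} : start H (rev P) x0 D (size P - m.+1) by apply: st; [lia | ].
case/orP=> [|att]; first by move=> ?; apply/orP; left; lia.
have [->|neq] := eqVneq m.+1 (size P); first by [].
move: att; rewrite /attached nth_rev; last by lia.
by have -> : size P - (size P - m.+1).-1.+1 = m.+1 by lia.
Qed.

End Detached.

(** * Structure of the closure when no spanning tree has few leaves *)

Section Structure.
Variables (T : finType) (H : sgraph T) (C : {set T}) (k t : nat).
Hypotheses (clC : clique H C) (conH : t_connected t H) (t_gt0 : 0 < t) (le_tC : t <= #|C|).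
Hypotheses (k_gt1 : 1 < k) (ltOC : #|~: C| < k + t).
Hypothesis no_tree : ~ has_spanning_ended_tree k H.
Implicit Type P : seq T.

Let nb o := [set y | H o y].

Lemma has_spanning_ended_tree_leq l m : l <= m ->
  has_spanning_ended_tree l H -> has_spanning_ended_tree m H.
Proof. by move=> le_lm [F [sF tF le_l]]; exists F; split=> //; apply: leq_trans le_lm. Qed.

Lemma t_connected_connected : connected H.
Proof. by apply: conH.2; rewrite cards0. Qed.

Lemma covering_path_cons P : max_covering_path H C P -> exists x s,
  [/\ P = x :: s, uniq (x :: s) & path H x s].
Proof.
move=> maxP; have := size_path_gt0 t_gt0 le_tC maxP; case: maxP => -[].
by case: P => // x s uP sP _ _ _; exists x, s.
Qed.

(** Having no tree forces at least [k - 1] vertices off [P], and [P] has at least [t] vertices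
    outside [C]; the bound [ltOC] leaves room for equality only. *)
Lemma tight_sizes P : max_covering_path H C P ->
  [/\ size P = #|C| + t, #|T| - size P = k - 1 & #|~: C| = k + t - 1].
Proof.
move=> maxP; have [x [s [defP us path_s]]] := covering_path_cons maxP.
have big : k <= 1 + (#|T| - size P).
  rewrite leqNgt; apply/negP=> lt; apply: no_tree.
  apply: has_spanning_ended_tree_leq (spanning_tree_of_path t_connected_connected us path_s).
  by rewrite -defP.
have [o nPo] : exists o, o \notin P.
  apply: NNPP => all_in.
  have : #|T| <= size P.
    have uP : uniq P by rewrite defP.
    rewrite -cardsT -(card_uniqP uP) subset_leq_card //.
    by apply/subsetP=> y _; apply: contraT => nPy; case: all_in; exists y.
  by clear - big k_gt1; lia.
have [D detD] := component_detached H nPo.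
have ge := covering_path_size_ge o clC conH t_gt0 le_tC maxP detD.
have cardT := cardsC C; split; clear - big ge ltOC k_gt1 cardT; lia.
Qed.

Lemma nb_off_path P o y : max_covering_path H C P -> o \notin P -> H o y -> y \in P.
Proof.
move=> maxP nPo Hoy; apply: contraT => nPy; case: no_tree.
have [x [s [defP us path_s]]] := covering_path_cons maxP.
have [_ offE _] := tight_sizes maxP.
(* An edge leaving [Y] must end on [P]. It attaches to [P] a whole edge lying off [P], so that
   [1 + (k - 1)] leaves suffice. *)
pose Y := [set a | (a \notin P) && [exists b, (b \notin P) && H a b]].
have oY : o \in Y by rewrite inE nPo; apply/existsP; exists y; rewrite nPy.
have nYx : x \notin Y by rewrite inE defP mem_head.
have [a [b [aY nYb Hab]]] := connected_cut t_connected_connected oY nYx.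
move: aY; rewrite inE => /andP[nPa /existsP[c /andP[nPc Hac]]].
have bP : b \in P.
  apply: contraNT nYb => nPb; rewrite inE nPb; apply/existsP; exists a.
  by rewrite nPa edge_sym.
rewrite defP in bP nPa nPc offE; rewrite edge_sym in Hab.
apply: has_spanning_ended_tree_leq (spanning_tree_of_path_edge
  t_connected_connected us path_s bP nPa nPc Hab Hac).
by rewrite offE subnKC // ltnW.
Qed.

Lemma singleton_detached P o : max_covering_path H C P -> o \notin P ->
  detached H P [set o].
Proof.
move=> maxP nPo; split.
- by apply/set0Pn; exists o; rewrite set11.
- by move=> y /set1P->.
- move=> y z /set1P-> /set1P->; exists [::]; split=> //= y'; by rewrite !inE.
- by move=> y /set1P-> z nPz /(nb_off_path maxP nPo); rewrite (negPf nPz).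
Qed.

Section OffPath.
Variables (x0 : T) (P : seq T) (o : T).
Hypotheses (maxP : max_covering_path H C P) (nPo : o \notin P).
Let size_P : size P = #|C| + t. Proof. by have [] := tight_sizes maxP. Qed.
Let detP := singleton_detached maxP nPo.
Let x_ i := nth x0 P i.

Lemma attached1 i : attached H P x0 [set o] i = (x_ i \in nb o).
Proof.
rewrite inE edge_sym; apply/exists_inP/idP=> [[y /set1P->] //|Ho].
by exists o; rewrite ?set11.
Qed.

Lemma nb_attachments : nb o = attachments H P [set o].
Proof.
apply/setP=> y; rewrite !inE; apply/idP/andP=> [Hoy|[_ /exists_inP[z /set1P->]]].
  split; first exact: nb_off_path Hoy.
  by apply/exists_inP; exists o; rewrite ?set11 // edge_sym.
by rewrite edge_sym.
Qed.

Lemma card_nb : #|nb o| = t.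
Proof. by rewrite nb_attachments; apply: (card_attachments x0 clC conH t_gt0). Qed.

Lemma nb_on_path y : y \in nb o -> exists2 i, i < size P & y = x_ i.
Proof.
rewrite inE => /(nb_off_path maxP nPo) yP; exists (index y P); first by rewrite index_mem.
by rewrite /x_ nth_index.
Qed.

(** A vertex of [P] outside [C] is a start, and starts are not attached. *)
Lemma nb_sub_clique : nb o \subset C.
Proof.
apply/subsetP=> y yo; have [i iP yE] := nb_on_path yo; rewrite yE in yo *.
apply: contraT => nC.
have st := outside_clique_start clC conH t_gt0 le_tC maxP detP size_P iP nC.
by case: (not_start_attached maxP detP (ltnW iP) st); rewrite attached1 yo orbT.
Qed.

Lemma outside_clique_nbs j : j < size P -> x_ j \notin C ->
  (j.+1 < size P -> x_ j.+1 \in nb o) /\ (0 < j -> x_ j.-1 \in nb o).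
Proof.
move=> jP nC; split=> [j1P|j0].
  have := outside_clique_end clC conH t_gt0 le_tC maxP detP size_P jP nC.
  by rewrite attached1 => /orP[/eqP jE|//]; rewrite jE ltnn in j1P.
have := outside_clique_start clC conH t_gt0 le_tC maxP detP size_P jP nC.
by rewrite /start attached1 -leqn0 leqNgt j0.
Qed.

(** If [x_ i.+1] lies in [C], it is the only start there, so [x_ 0] lies outside [C]. From the last
    position [j < i] outside [C], the vertex [x_ j.+1] is a neighbour of [o] and [j.+2] is again a
    start, hence outside [C]. Maximality of [j] then leaves only [j.+1 = i]. *)
Lemma nb_next_outside i : i < size P -> x_ i \in nb o ->
  (i.+1 < size P /\ x_ i.+1 \notin C) \/ (0 < i /\ x_ i.-1 \notin C).
Proof.
move=> iP xio.
have nsa m le_mP st := @not_start_attached _ _ _ x0 _ _ maxP detP m le_mP st.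
have st1 : start H P x0 [set o] i.+1 by rewrite /start attached1 xio.
have i1P : i.+1 < size P.
  rewrite ltn_neqAle iP andbT; apply/eqP=> iE.
  by case: (nsa _ iP st1); rewrite iE eqxx.
have i_gt0 : 0 < i.
  rewrite lt0n; apply/eqP=> i0; case: (nsa i (ltnW iP)); rewrite ?attached1 ?xio ?orbT //.
  by rewrite /start i0.
have [nC|] := boolP (x_ i.+1 \notin C); first by left.
rewrite negbK => C1; right; split=> //; apply/negP=> Cp.
have stC m : m < size P -> start H P x0 [set o] m -> m != i.+1 -> x_ m \notin C.
  move=> mP st; apply: contraNN => mC; apply/eqP.
  exact: (starts_clique clC maxP detP mP i1P st st1 mC C1).
pose Q m := (m < i) && (x_ m \notin C).
have exQ : exists m, Q m.
  by exists 0; rewrite /Q i_gt0 stC // (ltn_trans i_gt0 iP).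
have boundQ m : Q m -> m <= i by case/andP=> /ltnW.
have [j /andP[ji nCj] jmax] := ex_maxnP exQ boundQ.
have jP := ltn_trans ji iP; have j1P := leq_ltn_trans ji iP.
have [att _] := outside_clique_nbs jP nCj; have {}att := att j1P.
have [j1i|j1i] := eqVneq j.+1 i; first by move: Cp; rewrite -j1i /= (negPf nCj).
have j2 : j.+2 <= i by rewrite ltn_neqAle j1i.
have nC2 : x_ j.+2 \notin C.
  apply: stC; first exact: leq_ltn_trans j2 iP.
    by rewrite /start attached1 att orbT.
  by rewrite neq_ltn ltnS j2.
have [j2i|j2i] := eqVneq j.+2 i.
  by move: nC2; rewrite j2i (subsetP nb_sub_clique).
have : Q j.+2 by rewrite /Q nC2 andbT ltn_neqAle j2i.
by move/jmax; rewrite ltnNge leqnSn.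
Qed.

End OffPath.

(** A neighbour of [o] stands next to a position outside [C]. That position is outside [C] on [P']
    too, which makes the same vertex a neighbour of [o']; both sets have [t] elements. *)
Lemma nb_eq x0 P P' o o' : max_covering_path H C P -> max_covering_path H C P' ->
  o \notin P -> o' \notin P' -> size P' = size P ->
  (forall i, i < size P -> (nth x0 P i \in C -> nth x0 P' i = nth x0 P i) /\
                           (nth x0 P i \notin C -> nth x0 P' i \notin C)) ->
  nb o = nb o'.
Proof.
move=> maxP maxP' nPo nP'o' sizeE same.
apply/eqP; rewrite eqEcard (card_nb x0 maxP nPo) (card_nb x0 maxP' nP'o') leqnn andbT.
apply/subsetP=> y yo; have [i iP yE] := nb_on_path x0 maxP nPo yo.
have iC : nth x0 P i \in C by rewrite -yE (subsetP (nb_sub_clique x0 maxP nPo)).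
rewrite yE in yo *; rewrite -((same i iP).1 iC).
have [[i1P nC]|[i0 nC]] := nb_next_outside maxP nPo iP yo.
  have := outside_clique_nbs maxP' nP'o' (_ : i.+1 < size P') ((same _ i1P).2 nC).
  by rewrite sizeE => /(_ i1P)[_ /(_ isT)].
have ip : i.-1 < size P := leq_ltn_trans (leq_pred i) iP.
have := outside_clique_nbs maxP' nP'o' (_ : i.-1 < size P') ((same _ ip).2 nC).
by rewrite sizeE prednK // => /(_ (ltnW iP))[/(_ iP)].
Qed.

(** The path neighbours of a vertex outside [C] are neighbours of [o], so [o] can take its place. *)
Lemma swap_covering_path x0 P o j : max_covering_path H C P -> o \notin P ->
  j < size P -> nth x0 P j \notin C ->
  exists P', [/\ max_covering_path H C P', nth x0 P j \notin P', size P' = size P &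
    forall i, i < size P -> nth x0 P' i = if i == j then o else nth x0 P i].
Proof.
move=> maxP nPo jP nC; have [[uP sP sCP] max] := maxP.
pose f y := if y == nth x0 P j then o else y.
have nthE i : i < size P -> nth x0 (map f P) i = if i == j then o else nth x0 P i.
  by move=> iP; rewrite (nth_map x0) // /f nth_uniq.
have neq y : y \in P -> y != o by apply: contraTneq => ->.
have [nbR nbL] := outside_clique_nbs maxP nPo jP nC.
exists (map f P); split; rewrite ?size_map //; last first.
  apply/negP=> /mapP[y yP]; rewrite /f; case: eqVneq => [_ xo|/eqP ne xy]; last by case: ne.
  by have := neq _ (mem_nth x0 jP); rewrite xo eqxx.
split; last by move=> Q /max; rewrite size_map.
split.
- rewrite map_inj_in_uniq // => y z yP zP; rewrite /f.
  case: eqVneq => [->|yj]; case: eqVneq => [->|zj] // yz.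
    by have := neq z zP; rewrite -yz eqxx.
  by have := neq y yP; rewrite yz eqxx.
- apply/(sortedP x0) => i; rewrite size_map => i1P; rewrite !nthE //; last exact: ltnW.
  have Hi : H (nth x0 P i) (nth x0 P i.+1) by apply: (sortedP x0 sP).
  have [ij|ij] := eqVneq i j.
    by rewrite -ij in nbR *; rewrite gtn_eqF //; have := nbR i1P; rewrite inE.
  have [i1j|//] := eqVneq i.+1 j.
  by have := nbL; rewrite -i1j => /(_ isT); rewrite inE edge_sym.
- move=> c cC; apply/mapP; exists c; first exact: sCP.
  by rewrite /f; case: eqVneq cC nC => // -> ->.
Qed.

Lemma extremal_structure : exists S : {set T},
  [/\ S \subset C, #|S| = t, #|~: C| = k + t - 1 &
      forall o y, o \notin C -> H o y = (y \in S)].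
Proof.
have [P maxP] := max_covering_path_exists clC.
have [size_P offE cardO] := tight_sizes maxP.
have [[uP _ _] _] := maxP.
have [o0 nPo0] : exists o, o \notin P.
  apply: NNPP => all_in; have : #|T| <= size P.
    rewrite -cardsT -(card_uniqP uP) subset_leq_card //.
    by apply/subsetP=> y _; apply: contraT => nPy; case: all_in; exists y.
  by clear - offE k_gt1; lia.
exists (nb o0); split=> //; first exact: (nb_sub_clique o0 maxP).
  exact: (card_nb o0 maxP).
(* A vertex [o] on [P] is first swapped with [o0], which yields a path [P'] that misses [o]. *)
move=> o y nCo; have [oP|nPo] := boolP (o \in P); last first.
  by rewrite (@nb_eq o0 P P o0 o) // inE.
have jP : index o P < size P by rewrite index_mem.
have xj : nth o0 P (index o P) = o by rewrite nth_index.
have nCj : nth o0 P (index o P) \notin C by rewrite xj.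
have [P' [maxP' nP' sizeE nthE]] := swap_covering_path maxP nPo0 jP nCj.
rewrite xj in nP'; rewrite (@nb_eq o0 P P' o0 o) ?inE // => i iP; rewrite nthE //.
case: eqVneq => [->|//]; split=> [iC|_]; first by rewrite iC in nCj.
by apply: contra nPo0; have [[_ _ sCP] _] := maxP; apply: sCP.
Qed.

End Structure.

(** * Identification with the extremal graph *)

Lemma Gstar_isomorphic (T : finType) (H : sgraph T) (C S : {set T}) (n k t : nat) :
  clique H C -> S \subset C -> #|S| = t -> #|~: C| = k + t - 1 -> #|T| = n ->
  k + 2 * t <= n -> 0 < k -> (forall o y, o \notin C -> H o y = (y \in S)) ->
  isomorphic H (Gstar n k t).
Proof.
move=> clC sSC cardS cardO cardT le_n k_gt0 HO.
have cardM : #|C :\: S| = n - k - 2 * t + 1.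
  rewrite cardsD (setIidPr sSC) cardS; have := cardsC C; rewrite cardO cardT.
  by clear - le_n k_gt0; lia.
(* The three summands enumerate [S], [C :\: S] and [~: C]; the isomorphism is the inverse of [g]. *)
pose g (z : 'I_t + ('I_(n - k - 2 * t + 1) + 'I_(k + t - 1))) : T := match z with
  | inl i => enum_val (cast_ord (esym cardS) i)
  | inr (inl i) => enum_val (cast_ord (esym cardM) i)
  | inr (inr i) => enum_val (cast_ord (esym cardO) i)
  end.
have gS i : g (inl i) \in S by apply: enum_valP.
have gM i : g (inr (inl i)) \in C :\: S by apply: enum_valP.
have gO i : g (inr (inr i)) \in ~: C by apply: enum_valP.
have gM' i : (g (inr (inl i)) \in C) && (g (inr (inl i)) \notin S).
  by have := gM i; rewrite inE andbC.
have gO' i : g (inr (inr i)) \notin C by have := gO i; rewrite inE.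
have gOS i : g (inr (inr i)) \notin S by apply: contra (gO' i); apply: (subsetP sSC).
have gSC i : g (inl i) \in C by apply: (subsetP sSC).
have cl : {in C &, forall x y, H x y = (x != y)}.
  move=> x y Cx Cy; have [->|ne] := eqVneq x y; first by rewrite edge_irr.
  by rewrite (cliqueP _ _ clC).
have inj_g : injective g.
  move=> [i|[i|i]] [j|[j|j]] gE; try by [].
  - by congr inl; apply/(@cast_ord_inj _ _ (esym cardS))/enum_val_inj.
  - by have /andP[_] := gM' j; rewrite -gE gS.
  - by have := gOS j; rewrite -gE gS.
  - by have /andP[_] := gM' i; rewrite gE gS.
  - by congr (inr (inl _)); apply/(@cast_ord_inj _ _ (esym cardM))/enum_val_inj.
  - by have := gO' j; rewrite -gE; have /andP[->] := gM' i.
  - by have := gOS i; rewrite gE gS.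
  - by have := gO' i; rewrite gE; have /andP[->] := gM' j.
  - by congr (inr (inr _)); apply/(@cast_ord_inj _ _ (esym cardO))/enum_val_inj.
have edge_g z w : H (g z) (g w) = Gstar n k t z w.
  case: z w => [i|[i|i]] [j|[j|j]].
  - by rewrite cl // (inj_eq inj_g) [RHS]andbT.
  - have /andP[Cj nSj] := gM' j; rewrite cl //; apply/eqP=> E.
    by move: nSj; rewrite -E gS.
  - by rewrite edge_sym HO ?gS.
  - have /andP[Cj nSj] := gM' i; rewrite cl //; apply/eqP=> E.
    by move: nSj; rewrite E gS.
  - have /andP[Ci _] := gM' i; have /andP[Cj _] := gM' j.
    by rewrite cl // (inj_eq inj_g) [RHS]andbT.
  - by have /andP[_ nS] := gM' i; rewrite edge_sym HO // (negPf nS).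
  - by rewrite HO ?gS.
  - by have /andP[_ nS] := gM' j; rewrite HO // (negPf nS).
  - by rewrite HO // (negPf (gOS j)).
have [f gK fK] : bijective g.
  apply: inj_card_bij inj_g _; rewrite cardT !card_sum !card_ord.
  by clear - le_n k_gt0; lia.
exists f; first by exists g.
by move=> x y; rewrite -edge_g !fK.
Qed.

(** * The spectral bound *)

Local Open Scope ring_scope.

Section Rayleigh.
Local Open Scope sesquilinear_scope.

(** Over [R[i]] the matrix is hermitian, hence unitarily diagonalisable with real diagonal. Its
    diagonal entries are eigenvalues of [A] over [R], hence at most [rho], and the claim is read off
    in the coordinates [y]. *)
Lemma rayleigh_le_eigenvalue (R : rcfType) m (A : 'M[R]_m) (rho : R) :
  A^T = A -> (forall a, eigenvalue A a -> a <= rho) ->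
  forall x : 'rV_m, (x *m A *m x^T) 0 0 <= rho * (x *m x^T) 0 0.
Proof.
move=> symA maxA x.
pose f : {rmorphism R -> R[i]} := real_complex R.
have conjf p q (M : 'M[R]_(p, q)) : map_mx Num.conj (map_mx f M) = map_mx f M.
  by apply/matrixP=> i j; rewrite !mxE; apply: conj_Creal; apply/complex_realP; eexists.
pose B := map_mx f A.
have Bherm : B \is hermsymmx.
  by apply/is_hermitianmxP; rewrite expr0 scale1r -[in RHS]map_trmx conjf map_trmx symA.
have Bnormal := hermitian_normalmx Bherm.
set P := spectralmx B; set D := spectral_diag B.
have defB : B = invmx P *m diag_mx D *m P by apply/orthomx_spectralP.
have Pu : P \is unitarymx := spectral_unitarymx B.
have Punit : P \in unitmx := unitarymx_unit Pu.
have PB : P *m B = diag_mx D *m P by rewrite defB !mulmxA mulmxV // mul1mx.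
have Dle i : D 0 i <= f rho.
  have /mxOverP/(_ 0 i) := hermitian_spectral_diag_real Bherm.
  rewrite -/D => /complex_realP [a Da]; rewrite Da lecR; apply: maxA.
  rewrite -(eigenvalue_map f) -/B; apply/eigenvalueP; exists (row i P).
    rewrite -row_mul PB; apply/rowP=> j; rewrite !mxE (bigD1 i) //= big1 => [|l ne_li].
      by rewrite !mxE eqxx mulr1n addr0 Da.
    by rewrite !mxE eq_sym (negPf ne_li) mul0r.
  apply: contraTneq Punit => ri0; rewrite -row_free_unit; apply/row_freePn.
  by exists i; rewrite ri0 sub0mx.
pose y := map_mx f x *m P^t*.
have xE : map_mx f x^T = (map_mx f x)^t*.
  by rewrite -[LHS]conjf; apply/matrixP=> i j; rewrite !mxE.
have yE : y^t* = P *m map_mx f x^T.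
  by rewrite /y trmx_mul map_mxM trmxCK xE.
have xAx : f ((x *m A *m x^T) 0 0) = (y *m diag_mx D *m y^t*) 0 0.
  have -> : y *m diag_mx D *m y^t* = map_mx f x *m B *m map_mx f x^T.
    by rewrite yE /y -invmx_unitary // [in RHS]defB !mulmxA.
  by rewrite /B -!map_mxM [RHS]mxE.
have xx : f ((x *m x^T) 0 0) = (y *m y^t*) 0 0.
  have -> : y *m y^t* = map_mx f x *m map_mx f x^T.
    by rewrite yE /y !mulmxA mulmxKtV.
  by rewrite -map_mxM [RHS]mxE.
rewrite -lecR -[leLHS]/(f _) -[leRHS]/(f _) rmorphM xAx xx.
rewrite !mxE mulr_sumr; apply: ler_sum => i _.
rewrite mul_mx_diag !mxE mulrAC mulrC; apply: ler_wpM2r => //.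
exact: mul_conjC_ge0.
Qed.

End Rayleigh.

(** As the entries are nonnegative, passing to absolute values also bounds the quadratic form from
    below by [- rho] times the squared norm. Adding the upper bound at [e + c *: d] to the lower
    bound at [e - c *: d] gives [key], which is used at [c = rho^-1]. *)
Lemma sum_sq_row_sums_le (R : rcfType) m (A : 'M[R]_m) (rho : R) :
  A^T = A -> (forall i j, 0 <= A i j) -> (forall a, eigenvalue A a -> a <= rho) ->
  0 <= rho -> \sum_i (\sum_j A i j) ^+ 2 <= rho ^+ 2 * m%:R.
Proof.
move=> symA A_ge0 maxA rho_ge0.
have Q := rayleigh_le_eigenvalue symA maxA.
have QE (x : 'rV[R]_m) : (x *m A *m x^T) 0 0 = \sum_i \sum_j x 0 i * A i j * x 0 j.
  rewrite mxE exchange_big /=; apply: eq_bigr => j _; rewrite !mxE mulr_suml.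
  by [].
have NE (x : 'rV[R]_m) : (x *m x^T) 0 0 = \sum_i x 0 i ^+ 2.
  by rewrite mxE; apply: eq_bigr => j _; rewrite mxE -expr2.
have Qabs (x : 'rV[R]_m) : - (x *m A *m x^T) 0 0 <= rho * (x *m x^T) 0 0.
  pose z : 'rV[R]_m := \row_j `|x 0 j|.
  apply: (@le_trans _ _ (rho * (z *m z^T) 0 0)).
    apply: le_trans (Q _); rewrite !QE -sumrN; apply: ler_sum => i _.
        rewrite -sumrN; apply: ler_sum => j _; rewrite !mxE.
    rewrite -[A i j in leRHS]ger0_norm // -!normrM.
    by rewrite -normrN ler_norm.
  by rewrite !NE ler_wpM2l //; apply: ler_sum => i _; rewrite !mxE real_normK ?num_real.
pose e : 'rV[R]_m := const_mx 1.
pose d := e *m A.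
have dE j : d 0 j = \sum_i A j i.
  rewrite mxE; apply: eq_bigr => i _; rewrite mxE mul1r.
  by rewrite -[in LHS]symA mxE.
set S := \sum_i _.
have SE : S = (d *m d^T) 0 0 by rewrite NE; apply: eq_bigr => i _; rewrite dE.
have eE : (e *m e^T) 0 0 = m%:R.
  rewrite NE (eq_bigr (fun=> 1)) ?sumr_const ?card_ord // => i _.
  by rewrite mxE expr1n.
have dAe : (d *m A *m e^T) 0 0 = S by rewrite -mulmxA -[A]symA -trmx_mul SE.
have de : (d *m e^T) 0 0 = (e *m d^T) 0 0.
  by rewrite -[in LHS](trmxK d) -trmx_mul mxE.
have expand (M : 'M[R]_m) (c : R) : ((e + c *: d) *m M *m (e + c *: d)^T) 0 0 =
    (e *m M *m e^T) 0 0 + c * (e *m M *m d^T) 0 0 + c * (d *m M *m e^T) 0 0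
    + c ^+ 2 * (d *m M *m d^T) 0 0.
  have -> : (e + c *: d)^T = e^T + c *: d^T by apply/matrixP => i j; rewrite !mxE.
  rewrite !mulmxDl !mulmxDr -!scalemxAl -!scalemxAr !mxE; ring.
have key (c : R) : 2 * c * S <= rho * (m%:R + c ^+ 2 * S).
  have := lerD (Q (e + c *: d)) (Qabs (e + (- c) *: d)).
  have nrm a : ((e + a *: d) *m (e + a *: d)^T) 0 0 =
               m%:R + 2 * a * (e *m d^T) 0 0 + a ^+ 2 * S.
    have := expand 1%:M a; rewrite !mulmx1 de eE -SE => ->; ring.
  rewrite !expand !nrm dAe -/d -SE; lra.
have S_ge0 : 0 <= S by apply: sumr_ge0 => i _; apply: sqr_ge0.
have [rho0|rho_neq0] := eqVneq rho 0.
  (* For [rho = 0], any positive [c] shows that [S] vanishes. *)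
  have := key 1; rewrite rho0; lra.
have := key rho^-1.
have -> : rho * (m%:R + rho^-1 ^+ 2 * S) = rho * m%:R + rho^-1 * S by field.
have rho_gt0 : 0 < rho by rewrite lt_def rho_neq0.
rewrite -(ler_pM2l rho_gt0) mulrDr !mulrA.
have -> : rho * 2 / rho * S = 2 * S by field.
have -> : rho / rho * S = S by field.
rewrite expr2; lra.
Qed.

Lemma adjmx_row_sum (R : nzRingType) (T : finType) (G : sgraph T) (i : 'I_#|T|) :
  \sum_j adjmx R G i j = (deg G (enum_val i))%:R.
Proof.
rewrite /deg -sum1_card natr_sum big_mkcond /=.
rewrite (eq_bigr (fun j => (G (enum_val i) (enum_val j))%:R)) => [|j _]; last by rewrite mxE.
rewrite -(big_enum_val (fun y => (G (enum_val i) y)%:R)) /=.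
by rewrite [LHS]big_mkcond [RHS]big_mkcond /=; apply: eq_bigr => y _; rewrite !inE; case: (G _ y).
Qed.

Lemma sum_sq_deg_le_eigenvalue (R : rcfType) (T : finType) (G : sgraph T) (rho : R) :
  (0 < #|T|)%N -> largest_adj_eigenvalue G rho ->
  0 <= rho /\ (\sum_x deg G x ^ 2)%:R <= rho ^+ 2 * #|T|%:R.
Proof.
move=> T_gt0 [_ maxG].
have symA : (adjmx R G)^T = adjmx R G.
  by apply/matrixP=> i j; rewrite !mxE edge_sym.
have A_ge0 i j : 0 <= adjmx R G i j by rewrite mxE ler0n.
have rho_ge0 : 0 <= rho.
  have := rayleigh_le_eigenvalue symA maxG (const_mx 1).
  rewrite [X in _ <= _ * X]mxE (eq_bigr (fun=> 1)) => [|i _]; last by rewrite !mxE mulr1.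
  rewrite sumr_const card_ord => le_rho.
  have : 0 <= rho * #|T|%:R.
    apply: le_trans le_rho; rewrite mxE; apply: sumr_ge0 => j _.
    by rewrite !mxE mulr1; apply: sumr_ge0 => i _; rewrite mxE mul1r.
  by rewrite pmulr_lge0 // ltr0n.
split=> //; have := sum_sq_row_sums_le symA A_ge0 maxG rho_ge0.
rewrite (eq_bigr (fun i => (deg G (enum_val i) ^ 2)%:R)) => [|i _].
  by rewrite -(big_enum_val (fun x => (deg G x ^ 2)%:R)) natr_sum.
by rewrite adjmx_row_sum natrX.
Qed.

(** Vertices nonadjacent in [H] have degree sum at most [#|T| - 2] there, hence at least [#|T|] in
    the complement, and [sum_deg_mul_le] applies. Passing from [H] to [G] only raises complement
    degrees. *)
Lemma sum_deg_compl_closed (T : finType) (G H : sgraph T) :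
  (0 < #|T|)%N -> subrel G H -> degree_sums_below (#|T| - 1) H ->
  (#|T| * (\sum_x deg (compl H) x) <= 2 * (\sum_x deg (compl G) x ^ 2))%N.
Proof.
move=> T_gt0 sGH closed.
apply: (@leq_trans (2 * (\sum_x deg (compl H) x ^ 2))); last first.
  rewrite leq_mul2l; apply: leq_sum => x _; rewrite leq_exp2r //.
  apply/subset_leq_card/subsetP=> y; rewrite !inE !complE => /andP[-> /=].
  exact/contra/sGH.
apply: sum_deg_mul_le => x y; rewrite complE => /andP[neq nHxy].
have := closed x y neq nHxy; have := deg_compl H x; have := deg_compl H y.
clear; lia.
Qed.

Theorem theorem4p4 (R : rcfType) (k t n : nat)
    (hk : (2 <= k)%N) (ht : (1 <= t)%N)
    (hn : (maxn (6 * k + 6 * t - 1) (k ^ 2 + k * t + t + 1) <= n)%N)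
    (T : finType) (G : sgraph T)
    (hT : #|T| = n) (hG : t_connected t G)
    (rho : R) (hrho : largest_adj_eigenvalue (compl G) rho)
    (hle : rho <= Num.sqrt ((k%:R + t%:R) * (n%:R - 2 * t%:R)
                            - 3 / 2 * k%:R ^+ 2 + k%:R / 2 - k%:R * t%:R
                            + 1 / 2 * t%:R ^+ 2 + 1 / 2 * t%:R - 1)) :
  has_spanning_ended_tree k G \/
  exists H : sgraph T,
    closure_of (n - 1) G H /\ isomorphic H (Gstar n k t).
Proof.
have [|no_tree] := classic (has_spanning_ended_tree k G); [by left | right].
have {hn} n_ge : (6 * (k + t) <= n.+1)%N by move: hn; rewrite geq_max; clear; lia.
have n_gt0 : (0 < n)%N by clear - n_ge hk; lia.
have [H [clH sGH closedH back]] := closure_exists k G.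
rewrite hT in clH closedH; exists H; split=> //.
have no_treeH : ~ has_spanning_ended_tree k H by move/back.
have conH := t_connected_sub sGH hG.
pose s := (k + t)%N.
have arith : (3 * s ^ 2 + 2 <= 2 * s * n + s)%N by rewrite /s; clear - n_ge hk; nia.
(* [K] is twice the radicand, that is, twice the edge bound for the complement; [arith] ensures that
   the subtraction does not truncate. *)
pose K := (2 * s * n + s - (3 * s ^ 2 + 2))%N.
have sumK : (\sum_x deg (compl H) x <= K)%N.
  have T_gt0 : (0 < #|T|)%N by rewrite hT.
  have [rho_ge0] := sum_sq_deg_le_eigenvalue T_gt0 hrho; rewrite hT => sq_le.
  have rho2 : rho ^+ 2 <= K%:R / 2.
    have KE : K%:R / 2 = (k%:R + t%:R) * (n%:R - 2 * t%:R)
        - 3 / 2 * k%:R ^+ 2 + k%:R / 2 - k%:R * t%:R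
        + 1 / 2 * t%:R ^+ 2 + 1 / 2 * t%:R - 1 :> R.
      by rewrite /K (natrB _ arith) !natrD !natrM ?natrX /s !natrD; field.
    rewrite -KE in hle; have K_ge0 : 0 <= K%:R / 2 :> R by rewrite divr_ge0 ?ler0n.
    by rewrite -(sqr_sqrtr K_ge0) lerXn2r ?nnegrE ?sqrtr_ge0.
  have closedT : degree_sums_below (#|T| - 1) H by rewrite hT.
  have := sum_deg_compl_closed T_gt0 sGH closedT; rewrite hT => le1.
  (* After multiplication by [n], the chain is: degree sum times [n], at most twice the sum of
     squared degrees, at most [2 * rho ^+ 2 * n], at most [K * n]. *)
  rewrite -(leq_pmul2l n_gt0); apply: leq_trans le1 _.
  rewrite -(ler_nat R) natrM [leRHS]natrM.
  have n_ge0 : 0 <= n%:R :> R by apply: ler0n.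
  have := ler_wpM2r n_ge0 rho2; lra.
have [||||C clC ltC] := @clique_of_sum_deg_compl T H s; rewrite ?hT //.
- by rewrite /s addn_gt0 ltnW.
- by move: sumK; rewrite /K; clear - arith; lia.
have cardT := cardsC C; rewrite hT in cardT.
have le_tC : (t <= #|C|)%N by clear - cardT ltC n_ge; rewrite /s in ltC; lia.
have [S [sSC cardS cardO HO]] := extremal_structure clC conH ht le_tC hk ltC no_treeH.
apply: (Gstar_isomorphic clC sSC cardS cardO hT) => //; last exact: ltnW.
by clear - n_ge; lia.
Qed.
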